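(* Let $X$ be a Banach space. For every $1<p<\infty$, the Malliavin derivative $D$, defined on $X$-valued cylindrical functions (considered as a linear operator on those $F\in\mathscr{C}(\Omega;X)$ with $F\in L^p(\Omega;X)$ and $DF\in L^p(\Omega;\nu_p(E;X))$), is closable as an operator from $L^p(\Omega;X)$ into $L^p(\Omega;\nu_p(E;X))$.
   Context: Poisson random measure: $(\Omega,\mathcal{F},\mathbb{P})$ is a probability space, $(E,\mathcal{E})$ a measurable space, and $N$ is a Poisson random measure on $(E,\mathcal{E})$ with $\sigma$-finite intensity measure $\mu$, i.e. a map $N:\Omega\times\mathcal{E}\to\mathbb{N}\cup\{\infty\}$ such that $N(B)$ is a random variable for each $B\in\mathcal{E}$, $N(\omega,\cdot)$ is a measure for each $\omega$, $N(B)$ is Poisson distributed with parameter $\mu(B)$ ($N(B)=\infty$ a.s. if $\mu(B)=\infty$), and $N(B_1),\dots,N(B_n)$ are independent for pairwise disjoint $B_1,\dots,B_n$. Put $\mathcal{E}_\mu=\{B\in\mathcal{E}:\mu(B)<\infty\}$ and $\tilde N(B)=N(B)-\mu(B)$ for $B\in\mathcal{E}_\mu$. Poisson $p$-norm: for a simple function $f=\sum_{j=1}^m\mathbf 1_{B_j}\otimes x_j$ with $x_j\in X$ and pairwise disjoint $B_j\in\mathcal{E}_\mu$, let $\tilde N(f)=\sum_j\tilde N(B_j)x_j$ and $\|f\|_{\nu_p(E;X)}=(\mathbb{E}\|\tilde N(f)\|_X^p)^{1/p}$. $\nu_p(E;X)$ is the completion of the space of simple functions in this norm. Cylindrical functions: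 a (real) cylindrical function is a random variable $F=f(N(B_1),\dots,N(B_M))$ with $M\ge 1$, $f:\mathbb{N}^M\to\mathbb{R}$ ($0\in\mathbb{N}$) and $B_1,\dots,B_M\in\mathcal{E}_\mu$, which may always be taken pairwise disjoint. $\mathscr{C}(\Omega)$ is the vector space of these, and $\mathscr{C}(\Omega;X)=\mathscr{C}(\Omega)\otimes X$ consists of all $F=\sum_{i=1}^n F_i\otimes x_i$ with $F_i\in\mathscr{C}(\Omega)$, $x_i\in X$. Malliavin derivative: writing $F=\sum_{i=1}^n f_i(N(\mathbf{B}))\otimes x_i\in\mathscr{C}(\Omega;X)$ with $N(\mathbf{B})=(N(B_1),\dots,N(B_M))$, $B_1,\dots,B_M\in\mathcal{E}_\mu$ pairwise disjoint, and $\mathbf{e}_m$ the $m$-th unit vector of $\mathbb{R}^M$, $$DF=\sum_{i=1}^n\sum_{m=1}^M\big(f_i(N(\mathbf{B})+\mathbf{e}_m)-f_i(N(\mathbf{B}))\big)\otimes(\mathbf 1_{B_m}\otimes x_i),$$ a random variable with values in $L^2(E,\mu)\otimes X$, in fact in the $X$-valued simple functions on $E$; it does not depend on the representation. *)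

(* Defs.v *)
From mathcomp Require Import all_boot all_order all_algebra.
From mathcomp Require Import all_classical all_reals all_analysis.
From mathcomp Require Import measurable_realfun.

Set Implicit Arguments.
Unset Strict Implicit.
Unset Printing Implicit Defensive.
Import Order.TTheory GRing.Theory Num.Theory.
Import numFieldNormedType.Exports.

Local Open Scope classical_set_scope.
Local Open Scope ring_scope.

Section Bochner_Lp.
Context {d : measure_display} {Omega : measurableType d} {R : realType}.
Context (P : probability Omega R) (p : R) {V : normedModType R}.

Definition simple_rv (s : Omega -> V) : Prop :=
  finite_set (range s) /\ forall v, measurable (s @^-1` [set v]).

Definition strongly_measurable (F : Omega -> V) : Prop :=
  exists2 s : nat -> Omega -> V, forall k, simple_rv (s k) &
    forall w, s ^~ w @ \oo --> F w.

Definition Lp_norm (F : Omega -> V) : \bar R :=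
  Lnorm P p%:E (fun w => `|F w|%:E).

(* The elements of L^p(Omega; V) are the classes, modulo P-a.s. equality, of
   the functions satisfying this predicate. *)
Definition in_Lp (F : Omega -> V) : Prop :=
  strongly_measurable F /\ (Lp_norm F < +oo)%E.

End Bochner_Lp.

(* A linear operator from L^p(Omega; X) to L^p(Omega; V) is given by its graph,
   a relation between representatives; membership in L^p is imposed on both
   sides, so that the operator is restricted to the F in L^p with A F in L^p.
   It is closable if F_k -> 0 and A F_k -> G imply G = 0. *)
Definition closable_Lp (d : measure_display) (Omega : measurableType d)
    (R : realType) (P : probability Omega R) (p : R) (X V : normedModType R)
    (A : (Omega -> X) -> (Omega -> V) -> Prop) : Prop :=
  forall (F_ : nat -> Omega -> X) (G_ : nat -> Omega -> V) (G : Omega -> V),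
    (forall k, [/\ in_Lp P p (F_ k), in_Lp P p (G_ k) & A (F_ k) (G_ k)]) ->
    in_Lp P p G ->
    Lp_norm P p (F_ k) @[k --> \oo] --> 0%E ->
    Lp_norm P p (fun w => G_ k w - G w) @[k --> \oo] --> 0%E ->
    {ae P, forall w, G w = 0}.

Section poisson_random_measure.
Context {d d' : measure_display}.
Context {Omega : measurableType d} {E : measurableType d'} {R : realType}.
Context (P : probability Omega R).
Context (mu : {sigma_finite_measure set E -> \bar R}).

(* That N(w, -) is a measure for every w, and that N(B) is a random variable
   for every measurable B, is part of the kernel structure. The Poisson
   weights are spelled out because poisson_pmf takes the value 1 at rate 0. *)
Definition is_poisson_random_measure (N : R.-ker Omega ~> E) : Prop :=
  [/\ (forall w B, measurable B ->
         N w B = +oo%E \/ exists k : nat, N w B = k%:R%:E),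
      (forall B, measurable B -> (mu B < +oo)%E -> forall k : nat,
         P [set w | N w B = k%:R%:E] =
           (fine (mu B) ^+ k / k`!%:R * expR (- fine (mu B)))%:E),
      (forall B, measurable B -> mu B = +oo%E ->
         {ae P, forall w, N w B = +oo%E}) &
      (forall (n : nat) (B : 'I_n -> set E) (S : 'I_n -> set (\bar R)),
         (forall j, measurable (B j)) -> trivIset setT B ->
         (forall j, measurable (S j)) ->
         P (\bigcap_(j in [set: 'I_n]) [set w | S j (N w (B j))]) =
         (\prod_(j < n) P [set w | S j (N w (B j))])%E)].

Definition finite_disjoint (M : nat) (B : 'I_M -> set E) : Prop :=
  (forall j, measurable (B j) /\ (mu (B j) < +oo)%E) /\ trivIset setT B.

Definition compensated (N : R.-ker Omega ~> E) (B : set E) (w : Omega) : R :=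
  fine (N w B) - fine (mu B).

(* N(B_1), ..., N(B_M) as natural numbers; an infinite value, which has
   probability zero if mu (B_m) is finite, is sent to 0. *)
Definition counts (N : R.-ker Omega ~> E) (M : nat) (B : 'I_M -> set E)
    (w : Omega) : 'I_M -> nat :=
  fun m => Num.truncn (fine (N w (B m))).

Definition add_unit (M : nat) (k : 'I_M -> nat) (m : 'I_M) : 'I_M -> nat :=
  fun j => (k j + (j == m))%N.

Section vector_valued.
Context {X : normedModType R}.

Definition step_fun (M : nat) (B : 'I_M -> set E) (x : 'I_M -> X) : E -> X :=
  fun e => \sum_(j < M) (\1_(B j) e : R) *: x j.

Definition is_step_fun (f : E -> X) : Prop :=
  exists (M : nat) (B : 'I_M -> set E) (x : 'I_M -> X),
    finite_disjoint B /\ f = step_fun B x.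

Definition compensated_integral (N : R.-ker Omega ~> E) (M : nat)
    (B : 'I_M -> set E) (x : 'I_M -> X) (w : Omega) : X :=
  \sum_(j < M) compensated N (B j) w *: x j.

Definition poisson_norm (N : R.-ker Omega ~> E) (p : R) (M : nat)
    (B : 'I_M -> set E) (x : 'I_M -> X) : \bar R :=
  Lp_norm P p (compensated_integral N B x).

(* V, together with the map iota, is the completion nu_p(E; X): iota maps the
   simple functions linearly and isometrically onto a dense subspace of the
   Banach space V. Values of iota outside the simple functions are irrelevant. *)
Definition is_poisson_completion (N : R.-ker Omega ~> E) (p : R)
    (V : completeNormedModType R) (iota : (E -> X) -> V) : Prop :=
  [/\ (forall (a : R) (f g : E -> X), is_step_fun f -> is_step_fun g ->
         iota (fun e => a *: f e + g e) = a *: iota f + iota g),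
      (forall (M : nat) (B : 'I_M -> set E) (x : 'I_M -> X),
         finite_disjoint B ->
         `|iota (step_fun B x)|%:E = poisson_norm N p B x) &
      closure (iota @` [set f | is_step_fun f]) = [set: V]].

(* A representation \sum_i f_i(N(B_1), ..., N(B_M)) (x) x_i of an X-valued
   cylindrical function. *)
Record cylindrical := Cylindrical {
  cyl_dim : nat;
  cyl_dim_gt0 : (0 < cyl_dim)%N;
  cyl_set : 'I_cyl_dim -> set E;
  cyl_setP : finite_disjoint cyl_set;
  cyl_size : nat;
  cyl_coef : 'I_cyl_size -> ('I_cyl_dim -> nat) -> R;
  cyl_vec : 'I_cyl_size -> X
}.

Definition cyl_eval (N : R.-ker Omega ~> E) (c : cylindrical) (w : Omega) : X :=
  \sum_(i < cyl_size c) cyl_coef i (counts N (@cyl_set c) w) *: cyl_vec i.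

Definition cyl_deriv (N : R.-ker Omega ~> E) (c : cylindrical) (w : Omega) :
    E -> X :=
  fun e => \sum_(i < cyl_size c) \sum_(m < cyl_dim c)
    (cyl_coef i (add_unit (counts N (@cyl_set c) w) m)
     - cyl_coef i (counts N (@cyl_set c) w))
      *: ((\1_(cyl_set m) e : R) *: cyl_vec i).

(* The graph of D, with values in nu_p(E; X) through iota, on a.s. classes. *)
Definition malliavin (N : R.-ker Omega ~> E) (V : normedModType R)
    (iota : (E -> X) -> V) (F : Omega -> X) (G : Omega -> V) : Prop :=
  exists c : cylindrical,
    {ae P, forall w, F w = cyl_eval N c w} /\
    {ae P, forall w, G w = iota (cyl_deriv N c w)}.

End vector_valued.
End poisson_random_measure.

(* Main.v *)
(* For B of finite intensity, the Mecke formula bounds the mean of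
   || \int_B D_e F mu(de) || on the event {N(B) < L} by (L + mu(B)) E||F||.
   So if F_k -> 0 in L^p, all averages of D F_k over B tend to 0 in
   probability.  These averages control the Poisson norm: replacing a simple
   function psi by its averages over disjoint sets C_j amounts to taking the
   conditional expectation of its compensated integral given the N(C_j), which
   is a contraction.  Hence, for a simple function phi carried by the C_j,
   ||phi|| <= ||phi - psi|| + const * sum_j || \int_{C_j} psi dmu ||.
   Take psi = D F_k: if the limit G of D F_k were close to some phi with large
   norm on an event of positive probability, the right hand side would be too
   small there.  As G has essentially separable range, G = 0 a.s. *)
Require Import Defs.
From mathcomp Require Import all_boot all_order all_algebra.
From mathcomp Require Import all_classical all_reals all_analysis.
From mathcomp Require Import measurable_realfun ring lra.
Import Order.TTheory GRing.Theory Num.Theory.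
Import numFieldNormedType.Exports.
Local Open Scope classical_set_scope.
Local Open Scope ring_scope.

Set Implicit Arguments.
Unset Strict Implicit.
Unset Printing Implicit Defensive.

(** The sets on which [F_k] is built vary with [k]. The test sets [C_j] therefore stay fixed, every
    constant depends only on them and on [L], and each [F_k] meets them on a common refinement. The
    Poisson norm of the simple function [D F (w)] has its own expectation, taken with [w] frozen.
    The inequality between Poisson norms is thus deterministic and is applied path by path;
    randomness returns only when both sides are integrated over an event. Truncating at [N(B) < L]
    replaces the moments of [N(B)] that Hölder's inequality would call for; as counts are finite,
    letting [L] grow loses nothing. No vector-valued integral or conditional expectation is formed.
    Count vectors are discrete, so conditioning means restricting to a level event, and vectors
    occur only in finite sums with scalar integrals as coefficients. *)

(** * Random variables with countably many values *)

Section discrete_variables.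
Context {d : measure_display} {Omega : measurableType d} {R : realType}.
Context {T : countType} (Y : Omega -> T).
Hypothesis mY : forall t, measurable [set w | Y w = t].

Lemma measurable_discrete (A : set T) : measurable (Y @^-1` A).
Proof.
have -> : Y @^-1` A = \bigcup_(t in A) [set w | Y w = t].
  by apply/seteqP; split=> [w ?|w [t At /= e]]; [exists (Y w)|rewrite /= e].
rewrite bigcup_mkcond; apply: countable_bigcupT_measurable => // t.
by case: ifP => // _; exact: mY.
Qed.

Lemma measurable_fun_discrete d1 (T1 : measurableType d1) (g : T -> T1)
    (D : set Omega) : measurable D -> measurable_fun D (fun w => g (Y w)).
Proof.
move=> mD _ B mB; apply: measurableI => //.
exact: (measurable_discrete (g @^-1` B)).
Qed.

(** Indexing the fibres by [pickle] makes the sum a series over nat; numbers that code no value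
    contribute an empty fibre. *)
Lemma ge0_integral_fibers (P : {measure set Omega -> \bar R})
    (f : Omega -> \bar R) :
  measurable_fun setT f -> (forall w, 0 <= f w)%E ->
  (\int[P]_w f w =
   \sum_(n <oo) \int[P]_(w in [set w | pickle (Y w) = n]) f w)%E.
Proof.
move=> mf f0.
have UT : \bigcup_n [set w | pickle (Y w) = n] = setT.
  by apply/seteqP; split=> // w _; exists (pickle (Y w)).
rewrite -[in LHS]UT ge0_integral_bigcup //.
- by move=> n; apply: (measurable_discrete [set t | pickle t = n]).
- by rewrite UT.
- by apply/trivIsetP => i j _ _ ij; apply/seteqP; split=> // w [/= e e'];
    rewrite -e -e' eqxx in ij.
Qed.

End discrete_variables.

(** * Law of the count vectors and the Mecke formula *)

Section poisson_counts.
Context {d d' : measure_display}.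
Context {Omega : measurableType d} {E : measurableType d'} {R : realType}.
Context (P : probability Omega R).
Context (mu : {sigma_finite_measure set E -> \bar R}).
Context (N : R.-ker Omega ~> E) (hN : is_poisson_random_measure P mu N).
Implicit Types (I J : finType) (B : set E).

Lemma kernel_fiber_measurable B (y : \bar R) :
  measurable B -> measurable [set w | N w B = y].
Proof.
move=> mB.
have := measurable_kernel N B mB measurableT _ (emeasurable_set1 y).
by rewrite setTI.
Qed.

Lemma kernel_integral_cases w B : measurable B ->
  N w B = +oo%E \/ exists k : nat, N w B = k%:R%:E.
Proof. by case: hN => + _ _ _; apply. Qed.

Lemma poisson_weights_sum (r : R) : 0 <= r ->
  (\sum_(k <oo) (r ^+ k / k`!%:R * expR (- r))%:E = 1)%E.
Proof.
rewrite le_eqVlt => /orP[/eqP <-|r0].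
  rewrite nneseries_recl //.
  rewrite eseries0 => [|k /= k0 _]; last by rewrite expr0n gtn_eqF// mul0r mul0r.
  by rewrite /= expr0 oppr0 expR0 fact0 divr1 mulr1 adde0.
have := @probability_setT _ _ _ (poisson_prob r 0).
rewrite /= /poisson_prob r0 -nneseries_esumT; last first.
  by move=> *; rewrite lee_fin poisson_pmf_ge0.
move=> <-; apply: eq_eseriesr => k _.
by rewrite /poisson_pmf r0.
Qed.

(** The Poisson weights of the finite values already sum to 1. *)
Lemma kernel_infinite_null B : measurable B -> (mu B < +oo)%E ->
  P [set w | N w B = +oo%E] = 0%E.
Proof.
move=> mB muB.
have eC : [set w | N w B = +oo%E] =
    ~` \bigcup_(k : nat) [set w | N w B = k%:R%:E].
  apply/seteqP; split=> [w /= e [k _ /=]|w /= nk]; first by rewrite e.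
  by case: (kernel_integral_cases w mB) => // -[k ?]; case: nk; exists k.
have mU : measurable (\bigcup_(k : nat) [set w | N w B = k%:R%:E]).
  by apply: bigcupT_measurable => k; exact: kernel_fiber_measurable.
rewrite eC probability_setC // measure_bigcup //=; first last.
- by apply/trivIsetP => i j _ _ /eqP ij; apply/seteqP; split=> // w [/= -> [/eqP]];
    rewrite eqr_nat => /eqP.
- by move=> k _; exact: kernel_fiber_measurable.
rewrite (eq_eseriesr (g := fun k =>
   (fine (mu B) ^+ k / k`!%:R * expR (- fine (mu B)))%:E)); last first.
  by move=> k _; case: hN => _ + _ _; apply.
rewrite (eq_eseriesl (Q := xpredT)); last by move=> k; rewrite in_setT.
by rewrite poisson_weights_sum ?subee ?fine_ge0.
Qed.

(** Any finite index type is allowed, because the cells of a refinement are indexed by pairs of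
    options; over ['I_M] this is [finite_disjoint]. *)
Definition disjoint_family I (B : I -> set E) :=
  (forall i, measurable (B i) /\ (mu (B i) < +oo)%E) /\ trivIset setT B.

Definition rate I (B : I -> set E) (i : I) : R := fine (mu (B i)).

Lemma rate_ge0 I (B : I -> set E) i : 0 <= rate B i.
Proof. exact: fine_ge0. Qed.

(** Finite functions into nat form a countable type, which makes the count vector a discrete
    variable. *)
Definition cnt I (B : I -> set E) (w : Omega) : {ffun I -> nat} :=
  [ffun i => Num.truncn (fine (N w (B i)))].

(** An infinite count truncates to 0, hence the second alternative. The event takes the product form
    to which independence applies. *)
Lemma cnt_set I (B : I -> set E) (k : {ffun I -> nat}) :
  (forall i, measurable (B i)) ->
  [set w | cnt B w = k] = \bigcap_(i in setT)
    [set w | [set y : \bar R | y = (k i)%:R%:E \/ (y = +oo%E /\ k i = 0%N)]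
               (N w (B i))].
Proof.
move=> mB; apply/seteqP; split=> [w /= <- i _|w /= h].
  rewrite /= /cnt ffunE.
  case: (kernel_integral_cases w (mB i)) => [->|[k' ->]] /=.
    by right; rewrite Num.Theory.truncn0.
  by left; rewrite natrK.
apply/ffunP => i; rewrite ffunE.
case: (h i Logic.I) => [->|[-> ->]] /=; first by rewrite natrK.
by rewrite Num.Theory.truncn0.
Qed.

Lemma measurable_cnt_target (k : nat) :
  measurable [set y : \bar R | y = k%:R%:E \/ (y = +oo%E /\ k = 0%N)].
Proof.
have [->|k0] := eqVneq k 0%N.
  rewrite (_ : [set y | _] = [set 0%:E] `|` [set +oo%E]).
    by apply: measurableU; rewrite ?set_itv1; exact: emeasurable_set1.
  apply/seteqP; split=> y /=; first by case=> [|[]]; [left|right].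
  by case; [left|right].
rewrite (_ : [set y | _] = [set k%:R%:E]); first exact: emeasurable_set1.
apply/seteqP; split=> y /=; last by left.
by case=> // -[_ e]; rewrite e eqxx in k0.
Qed.

Lemma measurable_cnt I (B : I -> set E) (k : {ffun I -> nat}) :
  (forall i, measurable (B i)) -> measurable [set w | cnt B w = k].
Proof.
move=> mB; rewrite cnt_set //.
apply: fin_bigcap_measurable => [|i _]; first exact: finite_finset.
have := measurable_kernel N _ (mB i) measurableT _ (measurable_cnt_target (k i)).
by rewrite setTI.
Qed.

Definition poisson_weight (r : R) (k : nat) : R := r ^+ k / k`!%:R * expR (- r).

Lemma prob_cnt1 B (k : nat) : measurable B -> (mu B < +oo)%E ->
  P [set w | N w B = k%:R%:E \/ (N w B = +oo%E /\ k = 0%N)] =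
  (poisson_weight (fine (mu B)) k)%:E.
Proof.
move=> mB muB.
have mk := kernel_fiber_measurable k%:R%:E mB.
have <- : P [set w | N w B = k%:R%:E] = (poisson_weight (fine (mu B)) k)%:E.
  by case: hN => _ + _ _; apply.
have [k0|k0] := eqVneq k 0%N; last first.
  congr (P _); apply/seteqP; split=> w /=; last by left.
  by case=> // -[_ e]; rewrite e eqxx in k0.
rewrite (_ : [set w | _ \/ _] =
    [set w | N w B = k%:R%:E] `|` [set w | N w B = +oo%E]); last first.
  apply/seteqP; split=> w /=; first by case=> [|[]]; [left|right].
  by case; [left|right].
rewrite measureU0 //; first exact: kernel_fiber_measurable.
exact: kernel_infinite_null.
Qed.

Lemma prob_cnt I (B : I -> set E) (k : {ffun I -> nat}) : disjoint_family B ->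
  P [set w | cnt B w = k] = (\prod_i poisson_weight (rate B i) (k i))%:E.
Proof.
move=> [hB tB]; have mB i := (hB i).1.
pose S (i : I) := [set y : \bar R | y = (k i)%:R%:E \/ (y = +oo%E /\ k i = 0%N)].
rewrite cnt_set //.
rewrite (_ : \bigcap_(i in _) _ = \bigcap_(j in [set: 'I_#|I|])
   [set w | S (enum_val j) (N w (B (enum_val j)))]); last first.
  apply/seteqP; split=> w h i _; first exact: h.
  by have := h (enum_rank i) Logic.I; rewrite /S /= enum_rankK.
case: hN => _ _ _ /(_ _ (fun j : 'I_#|I| => B (enum_val j))
  (fun j => S (enum_val j))) -> //.
- rewrite (reindex_omap (fun j : 'I_#|I| => enum_val j)
     (fun i => Some (enum_rank i))) /=; last by move=> i _; rewrite enum_rankK.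
  rewrite -prodEFin; apply: eq_big => [j|j _]; first by rewrite enum_valK eqxx.
  by rewrite prob_cnt1 //; exact: (hB _).2.
- apply/trivIsetP => i j _ _ ij; move/trivIsetP : tB; apply => //.
  by apply: contra ij => /eqP /enum_val_inj ->.
- by move=> j; exact: measurable_cnt_target.
Qed.

Definition add1 I (k : {ffun I -> nat}) (i : I) : {ffun I -> nat} :=
  [ffun j => (k j + (j == i))%N].

(** This recursion is the only property of the Poisson weights behind the Mecke formula. *)
Lemma poisson_weight_shift (r : R) (k : nat) :
  k.+1%:R * poisson_weight r k.+1 = r * poisson_weight r k.
Proof.
rewrite /poisson_weight factS natrM invfM exprS !mulrA; congr (_ / _ * _).
by rewrite mulrC !mulrA mulVf ?pnatr_eq0// mul1r.
Qed.

(** By independence the factors of all indices other than [i] agree, and the factor of [i] is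
    [poisson_weight_shift]. If [k i = 0], both sides vanish: adding a point never leaves a zero
    count. *)
Lemma mecke_config I (B : I -> set E) (i : I) (k : {ffun I -> nat}) :
  disjoint_family B ->
  ((k i)%:R%:E * P [set w | cnt B w = k] =
   (rate B i)%:E * P [set w | add1 (cnt B w) i = k])%E.
Proof.
move=> fB; case E1 : (k i) => [|n].
  rewrite mul0e (_ : [set w | _] = set0) ?measure0 ?mule0 //.
  apply/seteqP; split=> // w /= /ffunP /(_ i).
  by rewrite ffunE eqxx E1 addn1.
pose k' : {ffun I -> nat} := [ffun j => (k j - (j == i))%N].
have kE : k = add1 k' i.
  apply/ffunP => j; rewrite !ffunE; case: eqP => [->|_]; last by rewrite subn0 addn0.
  by rewrite E1 subn1 addn1.
rewrite (_ : [set w | add1 _ _ = _] = [set w | cnt B w = k']); last first.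
  apply/seteqP; split=> w /=; last by move=> ->; rewrite -kE.
  by move=> e; apply/ffunP => j; rewrite !ffunE -e !ffunE addnK.
rewrite !prob_cnt // (bigD1 i) //= [in RHS](bigD1 i) //= -!EFinM.
rewrite [in LHS]mulrA [in RHS]mulrA.
congr (_ * _)%:E; last first.
  by apply: eq_bigr => j ji; rewrite ffunE (negbTE ji) subn0.
by rewrite /k' ffunE eqxx E1 subn1 /= poisson_weight_shift.
Qed.

(** The left integral is split along the values of the counts and the right one along the values of
    the shifted counts. Then [h] takes the same constant value on matching fibres, and
    [mecke_config] compares their masses. *)
Lemma mecke I (B : I -> set E) (i : I) (h : {ffun I -> nat} -> R) :
  disjoint_family B -> (forall k, 0 <= h k) ->
  (\int[P]_w ((cnt B w i)%:R * h (cnt B w))%:E =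
   (rate B i)%:E * \int[P]_w (h (add1 (cnt B w) i))%:E)%E.
Proof.
move=> fB h0; have mB j := (fB.1 j).1.
have mc k : measurable [set w | cnt B w = k] by exact: measurable_cnt.
have ms k : measurable [set w | add1 (cnt B w) i = k].
  exact: (measurable_discrete mc ((fun l => add1 l i) @^-1` [set k])).
rewrite (ge0_integral_fibers mc); first last.
- by move=> w; rewrite lee_fin mulr_ge0.
- exact: (measurable_fun_discrete mc (fun k => ((k i)%:R * h k)%:E)).
rewrite (ge0_integral_fibers ms); first last.
- by move=> w; rewrite lee_fin.
- exact: (measurable_fun_discrete ms (fun k => (h k)%:E)).
rewrite -nneseriesZl; last first.
  by move=> n _; apply: integral_ge0 => w _; rewrite lee_fin.
apply: eq_eseriesr => n _.
have [[k nk]|nk] := pselect (exists k : {ffun I -> nat}, pickle k = n); last first.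
  rewrite (_ : [set w | pickle (cnt B w) = n] = set0); last first.
    by apply/seteqP; split=> // w /= e; apply: nk; eexists; exact: e.
  rewrite (_ : [set w | _ = n] = set0); last first.
    by apply/seteqP; split=> // w /= e; apply: nk; eexists; exact: e.
  by rewrite !integral_set0 mule0.
have pE (Z : Omega -> {ffun I -> nat}) :
    [set w | pickle (Z w) = n] = [set w | Z w = k].
  by rewrite -nk; apply/seteqP; split=> w /=; [move=> /(pcan_inj pickleK)|move=> ->].
rewrite !pE.
under eq_integral => w /set_mem /= -> do [].
rewrite [X in (_ * X)%E](eq_integral (cst (h k)%:E)); last first.
  by move=> w /set_mem /= ->.
rewrite [LHS](integral_cst _ (mc k)) (integral_cst _ (ms k)).
by rewrite muleCA -(mecke_config i k fB) EFinM -!muleA [RHS]muleCA.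
Qed.

End poisson_counts.

(** * Finite unions, common refinements and block sums of counts *)

Section finite_unions.
Context {d : measure_display} {T : measurableType d} {R : realType}.

Lemma measure_finType_bigcup (m : {measure set T -> \bar R}) (K : finType)
    (Q : pred K) (F : K -> set T) :
  (forall k, measurable (F k)) -> trivIset setT F ->
  (m (\bigcup_(k in [set` Q]) F k) = \sum_(k | Q k) m (F k))%E.
Proof.
move=> mF tF; rewrite measure_fin_bigcup //; last exact: sub_trivIset tF.
have -> : [set` Q] = [set` enum Q] by apply/seteqP; split=> k /=; rewrite mem_enum.
by rewrite -fsbig_seq ?enum_uniq// big_enum.
Qed.

End finite_unions.

Section refinement.
Context {d d' : measure_display}.
Context {Omega : measurableType d} {E : measurableType d'} {R : realType}.
Context (P : probability Omega R).
Context (mu : {sigma_finite_measure set E -> \bar R}).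
Context (N : R.-ker Omega ~> E) (hN : is_poisson_random_measure P mu N).
Implicit Types (I J K : finType) (B : set E).

Lemma ae_finite_count B : measurable B -> (mu B < +oo)%E ->
  {ae P, forall w, N w B = (Num.truncn (fine (N w B)))%:R%:E}.
Proof.
move=> mB muB; exists [set w | N w B = +oo%E]; split.
- exact: kernel_fiber_measurable.
- exact: (kernel_infinite_null hN).
- move=> w /= nw; case: (kernel_integral_cases hN w mB) => // -[k kE].
  by case: nw; rewrite kE /= natrK.
Qed.

Lemma ae_finite_cells K (A : K -> set E) : disjoint_family mu A ->
  {ae P, forall w, forall k, N w (A k) = (cnt N A w k)%:R%:E}.
Proof.
move=> fA; apply: filter_forall => k.
have := ae_finite_count (fA.1 k).1 (fA.1 k).2.
by apply: filterS => w; rewrite /cnt ffunE.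
Qed.

Lemma rate_bigcup K (A : K -> set E) (Q : pred K) B :
  disjoint_family mu A -> B = \bigcup_(k in [set` Q]) A k ->
  fine (mu B) = \sum_(k | Q k) rate mu A k.
Proof.
move=> fA ->; rewrite measure_finType_bigcup //; last exact: fA.2.
  by rewrite -sum_fine // => k _; rewrite ge0_fin_numE // (fA.1 k).2.
by move=> k; exact: (fA.1 k).1.
Qed.

Lemma count_bigcup K (A : K -> set E) (Q : pred K) B w :
  disjoint_family mu A -> B = \bigcup_(k in [set` Q]) A k ->
  (forall k, N w (A k) = (cnt N A w k)%:R%:E) ->
  N w B = (\sum_(k | Q k) cnt N A w k)%N%:R%:E.
Proof.
move=> fA -> h; rewrite measure_finType_bigcup //; last exact: fA.2.
  by rewrite natr_sum -sumEFin; apply: eq_bigr.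
by move=> k; exact: (fA.1 k).1.
Qed.

Definition part I (C : I -> set E) (o : option I) : set E :=
  if o is Some i then C i else ~` \bigcup_(i in setT) C i.

(* Common refinement of two disjoint families; the cell outside all sets is
   replaced by the empty set because its measure may be infinite. *)
Definition refinement I J (C : I -> set E) (B : J -> set E)
    (o : option I * option J) : set E :=
  if o is (None, None) then set0 else part C o.1 `&` part B o.2.

Lemma part_trivIset I (C : I -> set E) : trivIset setT C ->
  trivIset setT (part C).
Proof.
move=> /trivIsetP tC; apply/trivIsetP => -[i|] [j|] _ _ // ij.
- by apply: tC => //; apply: contra ij => /eqP ->.
- by apply/seteqP; split=> // e [/= ei]; apply; exists i.
- by apply/seteqP; split=> // e [/= nj ej]; apply: nj; exists j.
Qed.

Lemma part_measurable I (C : I -> set E) (o : option I) :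
  (forall i, measurable (C i)) -> measurable (part C o).
Proof.
move=> mC; case: o => [i|] //=; apply: measurableC.
by apply: fin_bigcup_measurable => // i _.
Qed.

(** Every cell but the discarded one lies in some [C i] or some [B j], so its intensity is
    finite. *)
Lemma disjoint_family_refinement I J (C : I -> set E) (B : J -> set E) :
  disjoint_family mu C -> disjoint_family mu B ->
  disjoint_family mu (refinement C B).
Proof.
move=> fC fB.
have mC i := (fC.1 i).1; have mB j := (fB.1 j).1.
have mCp o : measurable (part C o) by exact: part_measurable.
have mBp o : measurable (part B o) by exact: part_measurable.
split.
  move=> [u v]; split.
    case: u v => [i|] [j|]; rewrite /refinement /=; last exact: measurable0.
    - exact: measurableI.
    - by apply: measurableI => //; exact: (mBp None).
    - by apply: measurableI => //; exact: (mCp None).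
  case: u v => [i|] v /=.
    apply: le_lt_trans (fC.1 i).2; apply: le_measure; rewrite ?inE //.
    exact: measurableI.
  case: v => [j|] /=; last by rewrite measure0.
  apply: le_lt_trans (fB.1 j).2; apply: le_measure; rewrite ?inE //.
  by apply: measurableI => //; exact: (mCp None).
apply/trivIsetP => -[u v] [u' v'] _ _ ne.
have : refinement C B (u, v) `&` refinement C B (u', v') `<=`
    (part C u `&` part C u') `&` (part B v `&` part B v').
  have sub o : refinement C B o `<=` part C o.1 `&` part B o.2.
    by case: o => -[i|] [j|].
  by move=> e [/sub [? ?] /sub [? ?]].
move=> h; apply/seteqP; split=> // e /h [e1 e2].
have [E1|n1] := eqVneq u u'; last first.
  by have /trivIsetP/(_ u u' Logic.I Logic.I n1) <- := part_trivIset fC.2.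
have [E2|n2] := eqVneq v v'; first by rewrite E1 E2 eqxx in ne.
by have /trivIsetP/(_ v v' Logic.I Logic.I n2) <- := part_trivIset fB.2.
Qed.

Lemma bigcup_part I (C : I -> set E) : \bigcup_(o in setT) part C o = setT.
Proof.
apply/seteqP; split=> // e _.
have [[i _ ei]|ne] := pselect ((\bigcup_(i in setT) C i) e); last by exists None.
by exists (Some i).
Qed.

Lemma refinement_bigcupl I J (C : I -> set E) (B : J -> set E) (i : I) :
  C i = \bigcup_(o in [set` (fun o => o.1 == Some i)]) refinement C B o.
Proof.
apply/seteqP; split=> [e ei|e [[u v]] /= /eqP /= ->]; last by case: v => [?|] [].
have : (\bigcup_(o in setT) part B o) e by rewrite bigcup_part.
by move=> [v _ ev]; exists (Some i, v); [apply/eqP|split].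
Qed.

Lemma refinement_bigcupr I J (C : I -> set E) (B : J -> set E) (j : J) :
  B j = \bigcup_(o in [set` (fun o => o.2 == Some j)]) refinement C B o.
Proof.
apply/seteqP; split=> [e ej|e [[[i|] v]] /= /eqP /= ->]; [|by case..].
have : (\bigcup_(o in setT) part C o) e by rewrite bigcup_part.
by move=> [u _ eu]; exists (u, Some j); [apply/eqP|case: u eu => [i|] eu; split].
Qed.

(* [None] stands for the cells outside all the blocks. *)
Definition block K J (sigma : K -> option J) (k : {ffun K -> nat}) :
    {ffun J -> nat} :=
  [ffun j => \sum_(a | sigma a == Some j) k a]%N.

(** The equality is only almost sure: where a cell has an infinite count, truncation to 0 destroys
    additivity. *)
Lemma ae_cnt_block K J (sigma : K -> option J) (A : K -> set E)
    (C : J -> set E) :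
  disjoint_family mu A ->
  (forall j, C j = \bigcup_(a in [set` (fun a => sigma a == Some j)]) A a) ->
  {ae P, forall w, cnt N C w = block sigma (cnt N A w)}.
Proof.
move=> fA hC; apply: filterS (ae_finite_cells fA) => w h.
apply/ffunP => j; rewrite !ffunE.
by rewrite (count_bigcup fA (hC j) h) /= natrK.
Qed.

Lemma rate_block K J (sigma : K -> option J) (A : K -> set E)
    (C : J -> set E) j :
  disjoint_family mu A ->
  (forall j, C j = \bigcup_(a in [set` (fun a => sigma a == Some j)]) A a) ->
  rate mu C j = \sum_(a | sigma a == Some j) rate mu A a.
Proof. by move=> fA hC; apply: rate_bigcup. Qed.

Lemma block_add1 K J (sigma : K -> option J) (k : {ffun K -> nat}) (a : K) :
  block sigma (add1 k a) =
  if sigma a is Some j then add1 (block sigma k) j else block sigma k.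
Proof.
have E1 j : (\sum_(b | sigma b == Some j) (b == a) = (sigma a == Some j))%N.
  have [e|ne] := eqVneq (sigma a) (Some j).
    rewrite (bigD1 a) ?e// eqxx big1 // => b /andP[_ /negbTE ->] //.
  rewrite big1 // => b bj; apply/eqP; rewrite eqb0; apply: contra ne => /eqP <-.
  exact: bj.
case e : (sigma a) => [j|]; apply/ffunP => j'; rewrite !ffunE.
  under eq_bigr do rewrite ffunE.
  by rewrite big_split /= E1 e (eqE (Some j)) /= eq_sym.
under eq_bigr do rewrite ffunE.
by rewrite big_split /= E1 e addn0.
Qed.

End refinement.

(** * Norms of integrals of discrete vector-valued variables *)

Section vector_integral.
Context {d : measure_display} {Omega : measurableType d} {R : realType}.
Context (P : probability Omega R) {T : countType} (Y : Omega -> T).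
Hypothesis mY : forall t, measurable [set w | Y w = t].

Lemma integrable_discreteS (f : T -> R) (U V : set T) : V `<=` U ->
  P.-integrable (Y @^-1` U) (EFin \o (f \o Y)) ->
  P.-integrable (Y @^-1` V) (EFin \o (f \o Y)).
Proof.
move=> VU; apply: integrableS; try exact: measurable_discrete.
by move=> w; exact: VU.
Qed.

(** Here only finitely many values occur, so integrals are finite sums. *)
Let below (V : set T) (n : nat) : set T := V `&` [set t | (pickle t < n)%N].

Lemma Rintegral_below_cvg (V : set T) (f : T -> R) :
  P.-integrable (Y @^-1` V) (EFin \o (f \o Y)) ->
  \int[P]_(w in Y @^-1` below V n) f (Y w) @[n --> \oo] -->
  \int[P]_(w in Y @^-1` V) f (Y w).
Proof.
move=> fi; have mV : measurable (Y @^-1` V) by exact: measurable_discrete.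
pose fn n w : \bar R := if (pickle (Y w) < n)%N then (f (Y w))%:E else 0%E.
have -> : (fun n => \int[P]_(w in Y @^-1` below V n) f (Y w)) =
    fun n => fine (\int[P]_(w in Y @^-1` V) fn n w)%E.
  apply/funext => n; rewrite /Rintegral; congr fine.
  rewrite [LHS]integral_mkcond [RHS]integral_mkcond.
  apply: eq_integral => w _; rewrite /patch /fn.
  have -> : (w \in Y @^-1` below V n) =
      (w \in Y @^-1` V) && (pickle (Y w) < n)%N.
    apply/idP/andP => [/set_mem[/= ? ?]|[/set_mem/= ? ?]].
      by split=> //; exact/mem_set.
    by apply/mem_set.
  by case: (w \in _) => //=; case: ifP.
apply: fine_cvg; rewrite fineK; last exact: integrable_fin_num.
have := @dominated_convergence _ _ _ P _ mV fn (fun w => (f (Y w))%:E)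
  (fun w => `|(f (Y w))%:E|%E).
case=> //.
- move=> n; apply: (measurable_fun_discrete mY
    (fun t => if (pickle t < n)%N then (f t)%:E else 0%E) mV).
- exact: (measurable_fun_discrete mY (fun t => (f t)%:E) mV).
- apply: aeW => w _; apply/cvg_ballP => e e0.
  near=> n; rewrite /fn ifT; first exact: ballxx.
  by near: n; exists (pickle (Y w)).+1.
- exact: integrable_abse.
- by apply: aeW => w n _; rewrite /fn; case: ifP => // _; rewrite abse0.
Unshelve. all: by end_near. Qed.

Lemma integrable_norm_sum {X : normedModType R} (K : finType) (V : set T)
    (g : K -> T -> R) (z : K -> X) :
  (forall a, P.-integrable (Y @^-1` V) (EFin \o (g a \o Y))) ->
  P.-integrable (Y @^-1` V)
    (EFin \o ((fun t => `|\sum_a g a t *: z a|) \o Y)).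
Proof.
move=> gi; pose G t : R := `|\sum_a g a t *: z a|.
have mV W : measurable (Y @^-1` W) by exact: measurable_discrete.
apply: (@le_integrable _ _ _ _ _ _ _
  (fun w => (\sum_(a <- index_enum K) `|z a|%:E * `|(g a (Y w))%:E|)%E)) => //.
- exact: (measurable_fun_discrete mY (fun t => (G t)%:E)).
- move=> w _ /=; rewrite sumEFin lee_fin /G normr_id.
  rewrite [leRHS]ger0_norm; last by apply: sumr_ge0 => a _; rewrite mulr_ge0.
  apply: (le_trans (ler_norm_sum _ _ _)); apply: ler_sum => a _.
  by rewrite normrZ mulrC.
- apply: integrable_sum; first exact: mV.
  move=> a _; apply: integrableZl; first exact: mV.
  by apply: integrable_abse; exact: gi.
Qed.

(** The integrand lies in the span of finitely many [z a], so integrating the scalar coefficients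
    suffices. On [below V n] the claim is the triangle inequality, by induction on [n]; dominated
    convergence then removes the restriction. *)
Lemma norm_sum_Rintegral_le {X : normedModType R} (K : finType) (V : set T)
    (g : K -> T -> R) (z : K -> X) :
  (forall a, P.-integrable (Y @^-1` V) (EFin \o (g a \o Y))) ->
  `|\sum_a (\int[P]_(w in Y @^-1` V) g a (Y w)) *: z a| <=
    \int[P]_(w in Y @^-1` V) `|\sum_a g a (Y w) *: z a|.
Proof.
move=> gi; pose G t : R := `|\sum_a g a t *: z a|.
have mV W : measurable (Y @^-1` W) by exact: measurable_discrete.
have Gi : P.-integrable (Y @^-1` V) (EFin \o (G \o Y)).
  exact: integrable_norm_sum.
have claim n : `|\sum_a (\int[P]_(w in Y @^-1` below V n) g a (Y w)) *: z a| <=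
    \int[P]_(w in Y @^-1` below V n) G (Y w).
  elim: n => [|n IHn].
    have -> : Y @^-1` below V 0 = set0.
      by apply/seteqP; split=> // w [].
    rewrite Rintegral_set0 big1 ?normr0 // => a _.
    by rewrite Rintegral_set0 scale0r.
  have eS : Y @^-1` below V n.+1 =
      Y @^-1` below V n `|` Y @^-1` (V `&` [set t | pickle t = n]).
    apply/seteqP; split=> w.
      move=> [Vw /=]; rewrite ltnS leq_eqVlt => /orP[/eqP ?|?]; first by right.
      by left.
    by case=> -[Vw /= h]; split=> //=; [exact: ltnW|rewrite h].
  have dS : [disjoint Y @^-1` below V n & Y @^-1` (V `&` [set t | pickle t = n])].
    apply/disj_setPS => w [[_ /= h] [_ /= e]].
    by rewrite e ltnn in h.
  have split_int f : P.-integrable (Y @^-1` V) (EFin \o (f \o Y)) ->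
      \int[P]_(w in Y @^-1` below V n.+1) f (Y w) =
      \int[P]_(w in Y @^-1` below V n) f (Y w) +
      \int[P]_(w in Y @^-1` (V `&` [set t | pickle t = n])) f (Y w).
    move=> fi; rewrite eS Rintegral_setU // -eS.
    by apply: integrable_discreteS fi => t [].
  rewrite (split_int G) // (eq_bigr (fun a =>
     (\int[P]_(w in Y @^-1` below V n) g a (Y w)) *: z a +
     (\int[P]_(w in Y @^-1` (V `&` [set t | pickle t = n])) g a (Y w)) *: z a));
     last by move=> a _; rewrite split_int // scalerDl.
  rewrite big_split /=; apply: (le_trans (ler_normD _ _)); apply: lerD => //.
  have [[t [Vt tn]]|nt] := pselect (exists t, V t /\ pickle t = n); last first.
    have -> : Y @^-1` (V `&` [set t | pickle t = n]) = set0.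
      by apply/seteqP; split=> // w [? ?]; apply: nt; exists (Y w).
    rewrite Rintegral_set0 big1 ?normr0 // => a _.
    by rewrite Rintegral_set0 scale0r.
  have cstE f : \int[P]_(w in Y @^-1` (V `&` [set t | pickle t = n])) f (Y w) =
      f t * fine (P (Y @^-1` (V `&` [set t | pickle t = n]))).
    rewrite -Rintegral_cst //; apply: eq_Rintegral => w /set_mem[_ /= e].
    by rewrite -tn in e; rewrite (pcan_inj pickleK e).
  rewrite cstE (eq_bigr (fun a =>
     fine (P (Y @^-1` (V `&` [set t | pickle t = n]))) *: (g a t *: z a))).
    by rewrite -scaler_sumr normrZ ger0_norm ?fine_ge0// mulrC.
  by move=> a _; rewrite cstE scalerA mulrC.
apply: (ler_cvg_to (a := \oo)); last by apply: nearW => n; exact: claim.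
  apply: cvg_norm; apply: cvg_big => [|a _]; first exact: add_continuous.
  apply: cvgZr_tmp.
  exact: Rintegral_below_cvg.
exact: Rintegral_below_cvg.
Qed.
End vector_integral.

(** * Jensen's inequality for powers on an event *)

Section jensen.
Context {d : measure_display} {Omega : measurableType d} {R : realType}.
Context (P : probability Omega R).

(* Young's inequality for s^(p-1) * t, integrated over U. *)
Lemma jensen_powR (U : set Omega) (t : Omega -> R) (s p : R) : 1 < p ->
  measurable U -> measurable_fun setT t -> (forall w, 0 <= t w) -> 0 <= s ->
  (s%:E * P U <= \int[P]_(w in U) (t w)%:E)%E ->
  ((s `^ p)%:E * P U <= \int[P]_(w in U) (t w `^ p)%:E)%E.
Proof.
move=> p1 mU mt t0 s0 h.
have p0 : 0 < p by exact: lt_trans p1.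
pose q : R := p / (p - 1).
have pn0 : p != 0 by rewrite gt_eqF.
have pm1 : 0 < p - 1 by rewrite subr_gt0.
have q0 : 0 < q by rewrite divr_gt0.
have pq : p^-1 + q^-1 = 1.
  by rewrite /q invf_div -{1}[p^-1]mul1r -mulrDl addrC subrK divff.
have mtU : measurable_fun U t by exact: measurable_funTS.
have mtp : measurable_fun U (fun w => (t w `^ p)%:E).
  by apply/measurable_EFinP; apply: (measurableT_comp (measurable_powR _)).
have young w : s `^ (p - 1) * t w <= p^-1 * t w `^ p + q^-1 * s `^ p.
  have := conjugate_powR (t0 w) (powR_ge0 s (p - 1)) p0 q0 pq.
  rewrite -powRrM /q [(p - 1) * _]mulrC divfK ?gt_eqF//.
  by rewrite [t w * _]mulrC [_ / p]mulrC [_ / (p / _)]mulrC.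
have PU : P U \is a fin_num by exact: fin_num_measure.
have : ((s `^ (p - 1))%:E * (s%:E * P U) <=
    p^-1%:E * \int[P]_(w in U) (t w `^ p)%:E + (q^-1 * s `^ p)%:E * P U)%E.
  apply: (le_trans (lee_wpmul2l _ h)); first by rewrite lee_fin powR_ge0.
  rewrite -ge0_integralZl //; first last.
  - by rewrite lee_fin powR_ge0.
  - by move=> w _; rewrite lee_fin.
  - exact/measurable_EFinP.
  rewrite -ge0_integralZl //; first last.
  - by rewrite lee_fin invr_ge0 ltW.
  - by move=> w _; rewrite lee_fin powR_ge0.
  rewrite -integral_cst // -ge0_integralD //; first last.
  - by move=> w _; rewrite lee_fin mulr_ge0 ?powR_ge0// invr_ge0 ltW.
  - exact: measurable_funeM.
  - by move=> w _; rewrite mule_ge0 // lee_fin ?powR_ge0// invr_ge0 ltW.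
  apply: ge0_le_integral => //.
  - by move=> w _; rewrite -EFinM lee_fin mulr_ge0 ?powR_ge0.
  - by apply: measurable_funeM; exact/measurable_EFinP.
  - by apply: emeasurable_funD => //; exact: measurable_funeM.
  - by move=> w _; rewrite /= -!EFinM -EFinD lee_fin.
have : (0 <= \int[P]_(w in U) (t w `^ p)%:E)%E.
  by apply: integral_ge0 => w _; rewrite lee_fin powR_ge0.
case: (\int[P]_(w in U) _)%E => [r| |] //; last by move=> _ _; rewrite leey.
move=> _; rewrite -(fineK PU) -!EFinM -EFinD !lee_fin mulrA.
have -> : s `^ (p - 1) * s = s `^ p.
  have [->|sn0] := eqVneq s 0; first by rewrite mulr0 powR0.
  rewrite -{2}[s]powRr1 // -powRD ?subrK //.
  by rewrite sn0 implybT.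
(* As [1 - q^-1 = p^-1], moving the second Young term to the left leaves the factor [p^-1] on both
   sides. *)
rewrite -lerBlDr -mulrA -[X in X - _]mul1r -mulrBl -{1}pq addrK.
by rewrite ler_pM2l ?invr_gt0.
Qed.

End jensen.

(** * Conditioning on the block counts *)

Section contraction.
Context {d d' : measure_display}.
Context {Omega : measurableType d} {E : measurableType d'} {R : realType}.
Context (P : probability Omega R).
Context (mu : {sigma_finite_measure set E -> \bar R}).
Context (N : R.-ker Omega ~> E) (hN : is_poisson_random_measure P mu N).
Context {K J : finType} (A : K -> set E) (sigma : K -> option J).
Hypothesis fA : disjoint_family mu A.

Let rC (j : J) : R := \sum_(a | sigma a == Some j) rate mu A a.

Let level (n : {ffun J -> nat}) : set {ffun K -> nat} :=
  [set k | block sigma k = n].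

Let U n : set Omega := cnt N A @^-1` level n.

Let mY k : measurable [set w | cnt N A w = k].
Proof. by apply: (measurable_cnt hN) => a; exact: (fA.1 a).1. Qed.

Let mU n : measurable (U n).
Proof. exact: (measurable_discrete mY). Qed.

(** This is Mecke with the indicator of the level as test function. *)
Lemma integral_cnt_level a n :
  (\int[P]_(w in U n) (cnt N A w a)%:R%:E =
   (rate mu A a)%:E * P [set w | block sigma (add1 (cnt N A w) a) = n])%E.
Proof.
pose h (k : {ffun K -> nat}) : R := (block sigma k == n)%:R.
have := mecke hN a fA (h := h) (fun k => ler0n _ _).
have mV : measurable [set w | block sigma (add1 (cnt N A w) a) = n].
  exact: (measurable_discrete mY [set k | block sigma (add1 k a) = n]).
rewrite (_ : (\int[P]_w (h (add1 (cnt N A w) a))%:E)%E =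
  P [set w | block sigma (add1 (cnt N A w) a) = n]); last first.
  rewrite -(setIT [set w | _ = n]) -integral_indic //.
  apply: eq_integral => w _; rewrite indicE /h; congr ((nat_of_bool _)%:R%:E).
  by apply/idP/idP => [/eqP/mem_set //|/set_mem/= ->].
move=> <-; rewrite integral_mkcond; apply: eq_integral => w _.
rewrite /patch /h; case: ifPn => [/set_mem/= e|e]; first by rewrite e eqxx mulr1.
case: eqP => [e'|_]; last by rewrite mulr0.
by move: e; rewrite mem_set.
Qed.

(** Mecke with the constant 1 bounds the mean count by the rate. *)
Lemma integrable_cnt a (V : set {ffun K -> nat}) :
  P.-integrable (cnt N A @^-1` V) (fun w => (cnt N A w a)%:R%:E).
Proof.
have mV : measurable (cnt N A @^-1` V) by exact: (measurable_discrete mY).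
apply: (@integrableS _ _ _ _ setT) => //.
have mc : measurable_fun setT (fun w => (cnt N A w a)%:R%:E : \bar R).
  exact: (measurable_fun_discrete mY (fun k => (k a)%:R%:E)).
apply/integrableP; split=> //.
under eq_integral do rewrite gee0_abs ?lee_fin//.
have := mecke hN a fA (h := fun=> 1) (fun k => ler01).
rewrite [X in X = _](eq_integral (fun w => (cnt N A w a)%:R%:E)); last first.
  by move=> w _; rewrite mulr1.
move=> ->; rewrite [X in (_ * X)%E](integral_cst P measurableT 1%E).
apply: (@le_lt_trans _ _ ((rate mu A a)%:E * 1)%E); last by rewrite mule1 ltry.
apply: lee_wpmul2l; first by rewrite lee_fin rate_ge0.
by rewrite mul1e; exact: probability_le1.
Qed.

Lemma integrable_centered_cnt a (V : set {ffun K -> nat}) :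
  P.-integrable (cnt N A @^-1` V)
    (EFin \o ((fun k : {ffun K -> nat} => (k a)%:R - rate mu A a) \o cnt N A)).
Proof.
have mV : measurable (cnt N A @^-1` V) by exact: (measurable_discrete mY).
rewrite (_ : EFin \o _ =
    ((fun w => (cnt N A w a)%:R%:E) \- cst (rate mu A a)%:E)%E).
  apply: (integrableB mV (integrable_cnt a V)).
  exact: finite_measure_integrable_cst.
by apply/funext => w /=; rewrite EFinB.
Qed.

Lemma sum_integral_cnt_level j n :
  (\sum_(a | sigma a == Some j) \int[P]_(w in U n) (cnt N A w a)%:R%:E =
   (n j)%:R%:E * P (U n))%E.
Proof.
rewrite -big_filter -ge0_integral_sum //.
- rewrite -integral_cst; last exact: mU.
  apply: eq_integral => w /set_mem /= <-.
  by rewrite big_filter sumEFin /block ffunE natr_sum.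
- by move=> a; apply: (measurable_fun_discrete mY (fun k => (k a)%:R%:E)).
Qed.

(* By Mecke, all the cells of a block involve the same probability q; summing
   over the block determines q. *)
Lemma Rintegral_cnt_level a n :
  \int[P]_(w in U n) ((cnt N A w a)%:R - rate mu A a) =
  (if sigma a is Some j then rate mu A a / rC j * ((n j)%:R - rC j) else 0)
    * fine (P (U n)).
Proof.
have PU : P (U n) \is a fin_num by exact: fin_num_measure.
rewrite /Rintegral.
rewrite (_ : (\int[P]_(w in U n) _)%E =
    (\int[P]_(w in U n) (cnt N A w a)%:R%:E -
     (rate mu A a)%:E * P (U n))%E); last first.
  rewrite -integral_cst // -integralB //.
  - exact: (integrable_cnt a (level n)).
  - exact: finite_measure_integrable_cst.
rewrite integral_cnt_level.
(* A point added outside all blocks leaves the block counts unchanged, so the centered integral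
   vanishes. *)
case sa : (sigma a) => [j|]; last first.
  rewrite (_ : [set w | _] = U n) ?subee ?mul0r ?fin_numM //.
  by apply/seteqP; split=> w /=; rewrite block_add1 sa.
set q := P [set w | _].
have qf : q \is a fin_num.
  apply: fin_num_measure.
  exact: (measurable_discrete mY [set k | block sigma (add1 k a) = n]).
have := sum_integral_cnt_level j n.
rewrite (eq_bigr (fun b => (rate mu A b * fine q)%:E)); last first.
  move=> b /eqP sb; rewrite integral_cnt_level EFinM (fineK qf).
  suff -> : P [set w | block sigma (add1 (cnt N A w) b) = n] = q by [].
  by congr (P _); apply/seteqP; split=> w /=; rewrite !block_add1 sa sb.
rewrite sumEFin -mulr_suml -/(rC j) -(fineK PU) -EFinM => -[rq].
rewrite -(fineK qf) -!EFinM -EFinB /=.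
(* In a block of rate 0 every cell has rate 0, and the quotient by [rC j] is 0 by convention. *)
have [rC0|rCn0] := eqVneq (rC j) 0.
  rewrite rC0 invr0 mulr0 !mul0r.
  have /eqP := rC0; rewrite psumr_eq0; last by move=> *; exact: rate_ge0.
  move=> /allP/(_ a (mem_index_enum _)); rewrite sa eqxx => /eqP ->.
  by rewrite !mul0r subrr.
have -> : fine q = (n j)%:R * fine (P (U n)) / rC j.
  by rewrite -rq mulrAC divff ?mul1r.
by field.
Qed.

(** On the level [U n] the left integrand is built from the constant [v n], and
    [fine (P (U n)) *: v n] is the integral of the sum on the right, by [Rintegral_cnt_level]. So
    [norm_sum_Rintegral_le] and [jensen_powR] give the inequality level by level. *)
Lemma block_average_contraction {X : normedModType R} (p : R) (z : K -> X) :
  1 < p ->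
  (\int[P]_w (`|\sum_j ((block sigma (cnt N A w) j)%:R - rC j) *:
       ((rC j)^-1 *: \sum_(a | sigma a == Some j) rate mu A a *: z a)| `^ p)%:E <=
   \int[P]_w (`|\sum_a ((cnt N A w a)%:R - rate mu A a) *: z a| `^ p)%:E)%E.
Proof.
move=> p1.
pose v (n : {ffun J -> nat}) := \sum_j ((n j)%:R - rC j) *:
  ((rC j)^-1 *: \sum_(a | sigma a == Some j) rate mu A a *: z a).
pose t (k : {ffun K -> nat}) := `|\sum_a ((k a)%:R - rate mu A a) *: z a|.
have mS n : measurable [set w | block sigma (cnt N A w) = n] by exact: mU.
rewrite (ge0_integral_fibers mS); first last.
- by move=> w; rewrite lee_fin powR_ge0.
- exact: (measurable_fun_discrete mS (fun n => (`|v n| `^ p)%:E)).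
rewrite [leRHS](ge0_integral_fibers mS); first last.
- by move=> w; rewrite lee_fin powR_ge0.
- exact: (measurable_fun_discrete mY (fun k => (t k `^ p)%:E)).
apply: lee_nneseries => [i _ _|i _].
  by apply: integral_ge0 => w _; rewrite lee_fin powR_ge0.
have [[n ni]|nn] := pselect (exists n : {ffun J -> nat}, pickle n = i); last first.
  rewrite (_ : [set w | _] = set0) ?integral_set0 //.
  by apply/seteqP; split=> // w /= e; apply: nn; eexists; exact: e.
rewrite (_ : [set w | _] = U n); last first.
  by rewrite -ni; apply/seteqP; split=> w /=; [move=> /(pcan_inj pickleK)|move=> ->].
rewrite (eq_integral (cst (`|v n| `^ p)%:E)); last by move=> w /set_mem /= <-.
rewrite [leLHS]integral_cst //.
apply: jensen_powR => //.
  exact: (measurable_fun_discrete mY t).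
have ti : P.-integrable (U n) (EFin \o (t \o cnt N A)).
  exact: (integrable_norm_sum mY z (g := fun a k => (k a)%:R - rate mu A a)
    (fun a => integrable_centered_cnt a (level n))).
rewrite -[leRHS]fineK; last exact: integrable_fin_num.
have PU : P (U n) \is a fin_num by exact: fin_num_measure.
rewrite -(fineK PU) -EFinM lee_fin.
apply: le_trans (norm_sum_Rintegral_le mY z (V := level n)
  (g := fun a k => (k a)%:R - rate mu A a) (fun a => integrable_centered_cnt a _)).
rewrite mulrC -[fine (P _)]ger0_norm ?fine_ge0// -normrZ le_eqVlt; apply/orP; left.
apply/eqP; congr `|_|.
under [RHS]eq_bigr do rewrite Rintegral_cnt_level mulrC -scalerA.
rewrite -scaler_sumr; congr (_ *: _).
rewrite /v (eq_bigr (fun j => \sum_(a | sigma a == Some j)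
   (rate mu A a / rC j * ((n j)%:R - rC j)) *: z a)); last first.
  move=> j _; rewrite scalerA scaler_sumr; apply: eq_bigr => a _.
  by rewrite scalerA; congr (_ *: _); rewrite mulrAC -mulrA mulrC.
rewrite (exchange_big_dep xpredT) //=; apply: eq_bigr => a _.
case sa : (sigma a) => [j|]; last by rewrite big_pred0 ?scale0r.
by rewrite (big_pred1 j) // => i0; rewrite eq_sym.
Qed.
End contraction.

Section big_option.
Context {V : Type} {idx : V} {op : Monoid.com_law idx}.

Lemma big_option (I : finType) (F : option I -> V) :
  \big[op/idx]_u F u = op (F None) (\big[op/idx]_i F (Some i)).
Proof.
rewrite (bigD1 None) //=; congr (op _ _).
rewrite (reindex_omap Some id) /=; last by case.
by apply: eq_bigl => i; rewrite eqxx.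
Qed.

Lemma big_pair_fst (J I : finType) (j : J) (F : J * I -> V) :
  \big[op/idx]_(a | a.1 == j) F a = \big[op/idx]_i F (j, i).
Proof.
rewrite (eq_bigl (fun a : J * I => (a.1 == j) && true)); last first.
  by move=> a; rewrite andbT.
rewrite (eq_bigr (fun a => F (a.1, a.2))); last by case.
rewrite -(pair_big (fun u => u == j) xpredT (fun u v => F (u, v))) /=.
by rewrite big_pred1_eq.
Qed.

End big_option.

(** * Truncated mean of the averaged derivative *)

Section derivative_estimate.
Context {d d' : measure_display}.
Context {Omega : measurableType d} {E : measurableType d'} {R : realType}.
Context (P : probability Omega R).
Context (mu : {sigma_finite_measure set E -> \bar R}).
Context (N : R.-ker Omega ~> E) (hN : is_poisson_random_measure P mu N).
Context {J I : finType} (C : J -> set E) (B : I -> set E).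
Hypothesis fC : disjoint_family mu C.
Hypothesis fB : disjoint_family mu B.

Let A := refinement C B.

Let fA : disjoint_family mu A.
Proof. exact: disjoint_family_refinement. Qed.

Let mY k : measurable [set w | cnt N A w = k].
Proof. by apply: (measurable_cnt hN) => a; exact: (fA.1 a).1. Qed.

(** The intensity of the intersection of [C j] and [B m]. With these weights, the values of a step
    function on [B] sum to its integral over [C j]. *)
Definition meet_rate (j : J) (m : I) : R := rate mu A (Some j, Some m).

Lemma sum_meet_rate_le j : \sum_m meet_rate j m <= rate mu C j.
Proof.
rewrite (rate_block (sigma := fst) j fA (refinement_bigcupl C B)).
by rewrite big_pair_fst big_option lerDr rate_ge0.
Qed.

(* The Mecke formula turns the shifted term into an unshifted one weighted by
   the number of points in C j, which is at most L after the shift. *)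
Lemma derivative_mean_le {X : normedModType R} (f : {ffun I -> nat} -> X)
    (j : J) (L : nat) :
  (\int[P]_(w in [set w | (cnt N C w j < L)%N])
     `|\sum_m meet_rate j m *: (f (add1 (cnt N B w) m) - f (cnt N B w))|%:E <=
   (L%:R + rate mu C j)%:E * \int[P]_w `|f (cnt N B w)|%:E)%E.
Proof.
pose F (k : {ffun option J * option I -> nat}) := f (block snd k).
(* The points of [C j] lying in some [B m]. They are exactly those that Mecke will count, and there
   are at most as many as in [C j]. *)
pose T (k : {ffun option J * option I -> nat}) :=
  (\sum_m k (Some j, Some m))%N.
have mcC n : measurable [set w | cnt N C w = n].
  by apply: (measurable_cnt hN) => a; exact: (fC.1 a).1.
have mcB n : measurable [set w | cnt N B w = n].
  by apply: (measurable_cnt hN) => a; exact: (fB.1 a).1.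
have aeB := ae_cnt_block hN (sigma := snd) fA (refinement_bigcupr C B).
have aeC := ae_cnt_block hN (sigma := fst) fA (refinement_bigcupl C B).
have mH : measurable [set w | (cnt N C w j < L)%N].
  exact: (measurable_discrete mcC [set n | (n j < L)%N]).
have T_le k : (T k <= block fst k j)%N.
  by rewrite /block ffunE /T big_pair_fst big_option leq_addl.
have T_add1 k m : T (add1 k (Some j, Some m)) = (T k).+1.
  rewrite /T; under eq_bigr do rewrite ffunE.
  rewrite big_split /= -addn1; congr addn; rewrite (bigD1 m) //= eqxx big1 //.
  move=> i im; rewrite xpair_eqE eqxx /=; case: eqP => // -[e].
  by rewrite e eqxx in im.
have F_add1 k m : F (add1 k (Some j, Some m)) = f (add1 (block snd k) m).
  by rewrite /F block_add1.
pose g m k : R := `|F (add1 k (Some j, Some m))| * (T k < L)%N%:R.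
have mA h : measurable_fun setT (fun w => (h (cnt N A w))%:E : \bar R).
  exact: (measurable_fun_discrete mY (fun k => (h k)%:E)).
have FE : (\int[P]_w `|f (cnt N B w)|%:E = \int[P]_w `|F (cnt N A w)|%:E)%E.
  apply: ge0_ae_eq_integral => //.
  - exact: (measurable_fun_discrete mcB (fun n => `|f n|%:E)).
  - exact: (mA (fun k => `|F k|)).
  - by apply: filterS aeB => w -> _.
apply: (@le_trans _ _ (\int[P]_w
    (\sum_m meet_rate j m * (g m (cnt N A w) + `|F (cnt N A w)|))%:E)%E).
  rewrite [leLHS]integral_mkcond.
  have r0 m : 0 <= meet_rate j m by exact: rate_ge0.
  have g0 m k : 0 <= g m k by rewrite mulr_ge0.
  apply: ae_ge0_le_integral => //.
  - by move=> w _; apply: erestrict_ge0 => v _; rewrite lee_fin.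
  - apply/(measurable_restrictT _ mH).
    apply: (measurable_fun_discrete mcB (fun n =>
      `|\sum_m meet_rate j m *: (f (add1 n m) - f n)|%:E) mH).
  - move=> w _; rewrite lee_fin; apply: sumr_ge0 => m _.
    by rewrite mulr_ge0 ?addr_ge0.
  - exact: (mA (fun k => \sum_m meet_rate j m * (g m k + `|F k|))).
  - apply: filterS2 aeB aeC => w eB eC _; rewrite /patch.
    case: ifPn => [/set_mem/= h|_].
      rewrite lee_fin; apply: (le_trans (ler_norm_sum _ _ _)); apply: ler_sum => m _.
      rewrite normrZ ger0_norm // ler_wpM2l //.
      rewrite eB -F_add1 -/(F _) (le_trans (ler_normB _ _)) // lerD2r /g.
      rewrite (_ : (T _ < L)%N) ?mulr1 //.
      by rewrite (leq_ltn_trans (T_le _)) // -eC.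
    by rewrite lee_fin; apply: sumr_ge0 => m _; rewrite mulr_ge0 ?addr_ge0.
(* The added point raises [T] by one, so [T < L] before the shift becomes [T <= L] after it. *)
have meckeE m : ((meet_rate j m)%:E * \int[P]_w (g m (cnt N A w))%:E =
    \int[P]_w ((cnt N A w (Some j, Some m))%:R *
       (`|F (cnt N A w)| * (T (cnt N A w) <= L)%N%:R))%:E)%E.
  rewrite (mecke hN (Some j, Some m) fA (h := fun k => `|F k| * (T k <= L)%N%:R)) //.
  congr (_ * _)%E; apply: eq_integral => w _.
  by rewrite /g T_add1.
have r0 m : 0 <= meet_rate j m by exact: rate_ge0.
under eq_integral do rewrite -sumEFin.
rewrite ge0_integral_sum //; first last.
- by move=> m w _; rewrite lee_fin mulr_ge0 ?addr_ge0 ?mulr_ge0.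
- by move=> m; exact: (mA (fun k => meet_rate j m * (g m k + `|F k|))).
have termE m : (\int[P]_w (meet_rate j m * (g m (cnt N A w) + `|F (cnt N A w)|))%:E =
   \int[P]_w ((cnt N A w (Some j, Some m))%:R *
       (`|F (cnt N A w)| * (T (cnt N A w) <= L)%N%:R))%:E +
   (meet_rate j m)%:E * \int[P]_w `|F (cnt N A w)|%:E)%E.
  under eq_integral do rewrite EFinM.
  rewrite ge0_integralZl //; first last.
  - by rewrite lee_fin.
  - by move=> w _; rewrite lee_fin addr_ge0 ?mulr_ge0.
  - exact: (mA (fun k => g m k + `|F k|)).
  under eq_integral do rewrite EFinD.
  rewrite ge0_integralD //; first last.
  - exact: (mA (fun k => `|F k|)).
  - by move=> w _; rewrite lee_fin mulr_ge0.
  rewrite ge0_muleDr -?meckeE //; apply: integral_ge0 => w _.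
    by rewrite lee_fin mulr_ge0.
  by rewrite lee_fin.
under eq_bigr do rewrite termE.
rewrite big_split /= FE EFinD ge0_muleDl ?lee_fin ?rate_ge0 //.
apply: leeD; last first.
  rewrite -ge0_sume_distrl; last by move=> m _; rewrite lee_fin.
  apply: lee_wpmul2r; first by apply: integral_ge0 => w _; rewrite lee_fin.
  by rewrite sumEFin lee_fin sum_meet_rate_le.
rewrite -ge0_integral_sum //; last first.
- by move=> m; exact: (mA (fun k : {ffun option J * option I -> nat} =>
    (k (Some j, Some m))%:R * (`|F k| * (T k <= L)%N%:R))).
rewrite -ge0_integralZl //; last first.
- exact: (mA (fun k => `|F k|)).
apply: ge0_le_integral => //.
- by move=> w _; apply: sume_ge0 => m _; rewrite lee_fin !mulr_ge0.
- apply: emeasurable_sum => m; exact: (mA (fun k : {ffun option J * option I -> nat} =>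
    (k (Some j, Some m))%:R * (`|F k| * (T k <= L)%N%:R))).
- exact: (mA (fun k => L%:R * `|F k|)).
- move=> w _; rewrite sumEFin -EFinM lee_fin -mulr_suml -natr_sum -/(T _).
  case: (leqP (T (cnt N A w)) L) => h; last by rewrite !mulr0 mulr_ge0.
  by rewrite mulr1 ler_wpM2r // ler_nat.
Qed.
End derivative_estimate.

(** * Poisson norms of step functions and their averages *)

Section completion_norm.
Context {d d' : measure_display}.
Context {Omega : measurableType d} {E : measurableType d'} {R : realType}.
Context (P : probability Omega R).
Context (mu : {sigma_finite_measure set E -> \bar R}).
Context (N : R.-ker Omega ~> E) (hN : is_poisson_random_measure P mu N).
Context {X : normedModType R} (p : R) (p1 : 1 < p).
Context {V : completeNormedModType R} (iota : (E -> X) -> V).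
Hypothesis hV : is_poisson_completion P mu N p iota.

Let p0 : 0 < p. Proof. exact: lt_trans p1. Qed.

Definition stepf (K : finType) (A : K -> set E) (z : K -> X) : E -> X :=
  fun e => \sum_a (\1_(A a) e : R) *: z a.

(* Also valid where N is infinite: [fine] and [cnt] are both 0 there. *)
Lemma compensatedE (K : finType) (A : K -> set E) a w : measurable (A a) ->
  compensated mu N (A a) w = (cnt N A w a)%:R - rate mu A a.
Proof.
move=> mA; rewrite /compensated /cnt ffunE; congr (_ - _).
by case: (kernel_integral_cases hN w mA) => [->|[k ->]] /=; rewrite ?truncn0 ?natrK.
Qed.

Lemma is_step_stepf (K : finType) (A : K -> set E) (z : K -> X) :
  disjoint_family mu A -> is_step_fun mu (stepf A z).
Proof.
move=> fA; exists #|K|, (fun j => A (enum_val j)), (fun j => z (enum_val j)).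
split; last by apply/funext => e; rewrite /stepf (reindex _ (onW_bij _ (enum_val_bij K))).
split; first by move=> j; exact: fA.1.
apply/trivIsetP => i j _ _ ij; have /trivIsetP := fA.2; apply => //.
by apply: contra ij => /eqP /enum_val_inj ->.
Qed.

Lemma iota_norm_powR (K : finType) (A : K -> set E) (z : K -> X) :
  disjoint_family mu A ->
  ((`|iota (stepf A z)| `^ p)%:E =
   \int[P]_w (`|\sum_a ((cnt N A w a)%:R - rate mu A a) *: z a| `^ p)%:E)%E.
Proof.
move=> fA; case: hV => _ h _.
have fA' : finite_disjoint mu (fun j : 'I_#|K| => A (enum_val j)).
  split; first by move=> j; exact: fA.1.
  apply/trivIsetP => i j _ _ ij; have /trivIsetP := fA.2; apply => //.
  by apply: contra ij => /eqP /enum_val_inj ->.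
have := h _ _ (fun j : 'I_#|K| => z (enum_val j)) fA'.
have -> : step_fun (fun j : 'I_#|K| => A (enum_val j)) (fun j => z (enum_val j)) =
    stepf A z.
  by apply/funext => e; rewrite /stepf (reindex _ (onW_bij _ (enum_val_bij K))).
rewrite -poweR_EFin => ->; rewrite /poisson_norm /Lp_norm.
have pn0 : p != 0 by rewrite gt_eqF.
rewrite (poweR_Lnorm P _ pn0).
apply: eq_integral => w _; rewrite gee0_abs ?lee_fin // poweR_EFin.
congr ((`|_| `^ _)%:E); rewrite /compensated_integral.
rewrite [RHS](reindex _ (onW_bij _ (enum_val_bij K))) /=; apply: eq_bigr => j _.
by rewrite compensatedE //; exact: (fA.1 _).1.
Qed.

Lemma iota_stepf_linear (K : finType) (A : K -> set E) (r : R) (u v : K -> X) :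
  disjoint_family mu A ->
  iota (stepf A (fun a => r *: u a + v a)) =
  r *: iota (stepf A u) + iota (stepf A v).
Proof.
move=> fA; case: hV => h _ _; rewrite -h; [|exact: is_step_stepf..].
congr iota; apply/funext => e; rewrite /stepf scaler_sumr -big_split /=.
by apply: eq_bigr => a _; rewrite scalerDr !scalerA mulrC.
Qed.

Lemma measurable_centered_sum (K : finType) (A : K -> set E) (z : K -> X) :
  disjoint_family mu A ->
  measurable_fun setT (fun w =>
    (`|\sum_a ((cnt N A w a)%:R - rate mu A a) *: z a| `^ p)%:E : \bar R).
Proof.
move=> fA; have mY k : measurable [set w | cnt N A w = k].
  by apply: (measurable_cnt hN) => a; exact: (fA.1 a).1.
exact: (measurable_fun_discrete mY (fun k : {ffun K -> nat} =>
  (`|\sum_a ((k a)%:R - rate mu A a) *: z a| `^ p)%:E)).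
Qed.

(** The Poisson norm sees only the compensated integral up to null events. This permits changing
    values on sets of intensity 0, where averages degenerate. *)
Lemma iota_norm_ae_eq (K K' : finType) (A : K -> set E) (A' : K' -> set E)
    (z : K -> X) (z' : K' -> X) :
  disjoint_family mu A -> disjoint_family mu A' ->
  {ae P, forall w, \sum_a ((cnt N A w a)%:R - rate mu A a) *: z a =
     \sum_a ((cnt N A' w a)%:R - rate mu A' a) *: z' a} ->
  `|iota (stepf A z)| = `|iota (stepf A' z')|.
Proof.
move=> fA fA' ae; apply: (powR_injective (r := p)) => //; try by rewrite nnegrE.
apply: EFin_inj; rewrite (iota_norm_powR z fA) (iota_norm_powR z' fA').
apply: ge0_ae_eq_integral.
- exact: measurableT.
- exact: measurable_centered_sum.
- exact: measurable_centered_sum.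
- by move=> w _; rewrite lee_fin powR_ge0.
- by move=> w _; rewrite lee_fin powR_ge0.
- by apply: filterS ae => w -> _.
Qed.

(** By Mecke with the constant 1, the mean count is 0. *)
Lemma ae_cnt_null (K : finType) (A : K -> set E) a : disjoint_family mu A ->
  rate mu A a = 0 -> {ae P, forall w, cnt N A w a = 0%N}.
Proof.
move=> fA r0; have mY k : measurable [set w | cnt N A w = k].
  by apply: (measurable_cnt hN) => b; exact: (fA.1 b).1.
have mc : measurable_fun setT (fun w => (cnt N A w a)%:R%:E : \bar R).
  exact: (measurable_fun_discrete mY (fun k : {ffun K -> nat} => (k a)%:R%:E)).
have := mecke hN a fA (h := fun=> 1) (fun k => ler01).
rewrite r0 mul0e => I0.
have /(ae_eq_integral_abs P measurableT mc) : (\int[P]_w `|(cnt N A w a)%:R%:E| = 0)%E.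
  by rewrite -I0; apply: eq_integral => w _; rewrite gee0_abs ?lee_fin // mulr1.
apply: filterS => w /(_ Logic.I) /= [] /eqP.
by rewrite pnatr_eq0 => /eqP.
Qed.

(* The constant is finite because [iota] takes values in a normed space; no
   moment of the Poisson distribution is computed. *)
Lemma iota_delta_bound (K : finType) (A : K -> set E) (a : K) : disjoint_family mu A ->
  exists2 kappa : R, 0 <= kappa & forall x : X,
    `|iota (stepf A (fun b => if b == a then x else 0))| <= kappa * `|x|.
Proof.
move=> fA; pose L x := `|iota (stepf A (fun b => if b == a then x else 0))|.
have LE x : ((L x `^ p)%:E = (`|x| `^ p)%:E *
    \int[P]_w (`|(cnt N A w a)%:R - rate mu A a| `^ p)%:E)%E.
  rewrite /L (iota_norm_powR _ fA) -ge0_integralZl; first last.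
  - by rewrite lee_fin powR_ge0.
  - by move=> w _; rewrite lee_fin powR_ge0.
  - have mY k : measurable [set w | cnt N A w = k].
      by apply: (measurable_cnt hN) => b; exact: (fA.1 b).1.
    exact: (measurable_fun_discrete mY (fun k : {ffun K -> nat} =>
      (`|(k a)%:R - rate mu A a| `^ p)%:E)).
  - exact: measurableT.
  apply: eq_integral => w _; rewrite -EFinM -powRM //; congr ((_ `^ _)%:E).
  rewrite (bigD1 a) //= eqxx big1 ?addr0; first by rewrite normrZ mulrC.
  by move=> b /negbTE ->; rewrite scaler0.
have [[x0 x0n]|triv] := pselect (exists x0 : X, x0 != 0); last first.
  exists 0 => // x; have -> : x = 0 by apply: contrapT => /eqP h; apply: triv; exists x.
  rewrite mul0r -/(L 0) le_eqVlt; apply/orP; left; apply/eqP.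
  apply: (powR_injective (r := p)) => //; rewrite ?nnegrE /L //.
  by apply: EFin_inj; rewrite -/(L 0) LE normr0 powR0 ?mul0e ?gt_eqF.
(* By [LE], the ratio of [L x] to the norm of [x] is the same for all nonzero [x], so any [x0]
   yields the constant. *)
exists (L x0 / `|x0|) => [|x]; first by rewrite divr_ge0 // /L.
rewrite -/(L x) mulrAC ler_pdivlMr ?normr_gt0// le_eqVlt; apply/orP; left; apply/eqP.
apply: (powR_injective (r := p)) => //; rewrite ?nnegrE ?mulr_ge0 /L //.
rewrite !powRM //; apply: EFin_inj; rewrite !EFinM -!/(L _) !LE.
by rewrite [LHS]muleC muleA [RHS]muleAC.
Qed.

Lemma iota_stepf_bound (K : finType) (A : K -> set E) : disjoint_family mu A ->
  exists2 kappa : K -> R, forall a, 0 <= kappa a & forall z : K -> X,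
    `|iota (stepf A z)| <= \sum_a kappa a * `|z a|.
Proof.
move=> fA; pose kappa a := s2val (cid2 (iota_delta_bound a fA)).
exists kappa => [a|z]; first by rewrite /kappa; case: cid2.
pose L u := iota (stepf A u).
have L0 : L (fun=> 0) = 0.
  have := iota_stepf_linear 1 (fun=> 0) (fun=> 0) fA.
  rewrite (_ : (fun=> _) = fun=> 0); last by apply/funext => a; rewrite scaler0 addr0.
  by rewrite scale1r => /eqP; rewrite -subr_eq0 opprD addNKr oppr_eq0 => /eqP.
have LD u v : L (fun a => u a + v a) = L u + L v.
  rewrite -[L u]scale1r -iota_stepf_linear //; congr L.
  by apply/funext => a; rewrite scale1r.
have Ls (s : seq K) : L (fun b => \sum_(a <- s) (if b == a then z a else 0)) =
    \sum_(a <- s) L (fun b => if b == a then z a else 0).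
  elim: s => [|a s IHs].
    by rewrite big_nil -[RHS]L0; congr L; apply/funext => b; rewrite big_nil.
  rewrite big_cons -IHs -LD; congr L; apply/funext => b; rewrite big_cons.
  by [].
have -> : iota (stepf A z) = \sum_a L (fun b => if b == a then z a else 0).
  rewrite -Ls; congr (iota (stepf A _)); apply/funext => b.
  rewrite (bigD1 b) //= eqxx big1 ?addr0 // => a /negbTE; rewrite eq_sym => -> //.
apply: (le_trans (ler_norm_sum _ _ _)); apply: ler_sum => a _.
by rewrite /kappa; case: cid2 => k k0 /= h; exact: h.
Qed.

Lemma indic_bigcup (K : finType) (A : K -> set E) (Q : pred K) (B : set E) e :
  trivIset setT A -> B = \bigcup_(k in [set` Q]) A k ->
  (\1_B e : R) = \sum_(k | Q k) \1_(A k) e.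
Proof.
move=> /trivIsetP tA ->; rewrite indicE.
have [[k Qk Ake]|nk] := pselect ((\bigcup_(k in [set` Q]) A k) e).
  rewrite mem_set; last by exists k.
  rewrite (bigD1 k) //= indicE mem_set // big1 ?addr0 // => i /andP[_ ik].
  rewrite indicE memNset // => Aie.
  by have := tA i k Logic.I Logic.I ik; move/seteqP => -[/(_ e) + _]; apply.
rewrite memNset // big1 // => i Qi; rewrite indicE memNset // => Aie.
by apply: nk; exists i.
Qed.

Definition extend0 (J : finType) (x : J -> X) (u : option J) : X :=
  if u is Some j then x j else 0.

Lemma stepf_coarse (K J : finType) (sigma : K -> option J) (A : K -> set E)
    (C : J -> set E) (x : J -> X) : disjoint_family mu A ->
  (forall j, C j = \bigcup_(a in [set` (fun a => sigma a == Some j)]) A a) ->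
  stepf C x = stepf A (fun a => extend0 x (sigma a)).
Proof.
move=> fA hC; apply/funext => e; rewrite /stepf.
rewrite [RHS](partition_big sigma xpredT) //= big_option /= [X in _ = X + _]big1.
  rewrite add0r; apply: eq_bigr => j _.
  rewrite (indic_bigcup _ fA.2 (hC j)) scaler_suml; apply: eq_bigr => a /eqP -> //.
by move=> a /eqP ->; rewrite /= scaler0.
Qed.

(** On the refinement, the difference of the two step functions is a single one, [z]; the left side
    carries its averages over the [C j]. The average is not simplified to [x j] minus a mean,
    because at rate 0 it must be 0. *)
Lemma block_average_norm_le (J I : finType) (C : J -> set E) (B : I -> set E)
    (x : J -> X) (y : I -> X) : disjoint_family mu C -> disjoint_family mu B ->
  `|iota (stepf C (fun j => (rate mu C j)^-1 *:
      (rate mu C j *: x j - \sum_m meet_rate mu C B j m *: y m)))| <=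
  `|iota (stepf C x) - iota (stepf B y)|.
Proof.
move=> fC fB; pose A := refinement C B.
have fA : disjoint_family mu A by exact: disjoint_family_refinement.
pose z (a : option J * option I) := extend0 x a.1 - extend0 y a.2.
have hC := refinement_bigcupl C B; have hB := refinement_bigcupr C B.
have rE j : rate mu C j = \sum_(a : option J * option I | a.1 == Some j) rate mu A a.
  exact: (rate_block (sigma := fst) j fA hC).
have zE j : \sum_(a : option J * option I | a.1 == Some j) rate mu A a *: z a =
    rate mu C j *: x j - \sum_m meet_rate mu C B j m *: y m.
  rewrite rE scaler_suml !big_pair_fst !big_option /z /= subr0 -addrA -sumrB.
  by congr (_ + _); apply: eq_bigr => m _; rewrite scalerBr.
have -> : iota (stepf C x) - iota (stepf B y) = iota (stepf A z).
  rewrite (stepf_coarse (sigma := fst) x fA hC) (stepf_coarse (sigma := snd) y fA hB).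
  rewrite addrC -scaleN1r -(iota_stepf_linear _ _ _ fA); congr (iota (stepf A _)).
  by apply/funext => a; rewrite scaleN1r addrC.
rewrite leNgt; apply/negP => lt_norm.
have := gt0_ltr_powR p0 (normr_ge0 _ : _ \in Num.nneg)
  (normr_ge0 _ : _ \in Num.nneg) lt_norm.
apply/negP; rewrite -leNgt -lee_fin (iota_norm_powR _ fC) (iota_norm_powR _ fA).
apply: le_trans (block_average_contraction hN fst fA z p1).
rewrite le_eqVlt; apply/orP; left; apply/eqP; apply: ge0_ae_eq_integral.
- exact: measurableT.
- exact: measurable_centered_sum.
- have mY k : measurable [set w | cnt N A w = k].
    by apply: (measurable_cnt hN) => a; exact: (fA.1 a).1.
  exact: (measurable_fun_discrete mY (fun k => (`|\sum_j
    ((block fst k j)%:R - \sum_(a : option J * option I | a.1 == Some j) rate mu A a) *: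
    ((\sum_(a : option J * option I | a.1 == Some j) rate mu A a)^-1 *:
      \sum_(a : option J * option I | a.1 == Some j) rate mu A a *: z a)| `^ p)%:E)).
- by move=> w _; rewrite lee_fin powR_ge0.
- by move=> w _; rewrite lee_fin powR_ge0.
- apply: filterS (ae_cnt_block hN (sigma := fst) fA hC) => w -> _.
  congr ((`|_| `^ _)%:E); apply: eq_bigr => j _.
  by rewrite zE -rE.
Qed.

(** The averages of the difference and those of the second function add up to the first. The
    constants are chosen before [B] and [y], so they serve all derivatives of a sequence and all
    paths. *)
Lemma step_norm_le (J : finType) (C : J -> set E) (x : J -> X) : disjoint_family mu C ->
  exists2 c : J -> R, forall j, 0 <= c j &
    forall (I : finType) (B : I -> set E) (y : I -> X), disjoint_family mu B ->
      `|iota (stepf C x)| <= `|iota (stepf C x) - iota (stepf B y)| +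
        \sum_j c j * `|\sum_m meet_rate mu C B j m *: y m|.
Proof.
move=> fC; have [kappa k0 hk] := iota_stepf_bound fC.
(* [kappa j] bounds the norm of a value placed on [C j]; the division turns the integral over [C j]
   into an average. *)
exists (fun j => kappa j / rate mu C j) => [j|I B y fB].
  by rewrite divr_ge0 ?rate_ge0.
pose S j := \sum_m meet_rate mu C B j m *: y m.
pose v j := (rate mu C j)^-1 *: (rate mu C j *: x j - S j).
pose u j := (rate mu C j)^-1 *: S j.
(* [v j + u j] is [x j] unless [C j] has rate 0; there the centered count is almost surely 0, so the
   value is immaterial. *)
have -> : `|iota (stepf C x)| = `|iota (stepf C (fun j => 1 *: v j + u j))|.
  apply: iota_norm_ae_eq => //.
  have : {ae P, forall w, forall j, rate mu C j = 0 -> cnt N C w j = 0%N}.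
    apply: filter_forall => j; have [r0|rn0] := eqVneq (rate mu C j) 0.
      by apply: filterS (ae_cnt_null fC r0) => w h _.
    by apply: nearW => w h; rewrite h eqxx in rn0.
  apply: filterS => w h; apply: eq_bigr => j _.
  have [r0|rn0] := eqVneq (rate mu C j) 0.
    by rewrite h // r0 subrr !scale0r.
  by congr (_ *: _); rewrite scale1r /v /u scalerBr subrK scalerA mulVf // scale1r.
rewrite (iota_stepf_linear _ _ _ fC) scale1r.
apply: (le_trans (ler_normD _ _)); apply: lerD.
  exact: block_average_norm_le.
apply: (le_trans (hk _)); apply: ler_sum => j _.
by rewrite /u normrZ normfV (ger0_norm (rate_ge0 _ _ _)) mulrA.
Qed.

End completion_norm.

(** * Measurability of norms and comparison with the mean *)

Section strong_measurability.
Context {d : measure_display} {Omega : measurableType d} {R : realType}.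
Context (P : probability Omega R).

(** [V] is not given a sigma-algebra; the preimage is cut along the finitely many values of [s] and
    [t] instead. *)
Lemma measurable_simple_normB (V : normedModType R) (s t : Omega -> V) :
  simple_rv s -> simple_rv t -> measurable_fun setT (fun w => `|s w - t w|).
Proof.
move=> [fs ms] [ft mt] _ B mB; rewrite setTI.
rewrite (_ : _ @^-1` B = \bigcup_(u in range s) \bigcup_(v in range t)
    (s @^-1` [set u] `&` t @^-1` [set v] `&` [set _ | B `|u - v|])); last first.
  apply/seteqP; split=> [w Bw|w [u _ [v _ [[/= -> ->] //]]]].
  by exists (s w); [exists w|exists (t w); [exists w|split]].
apply: fin_bigcup_measurable => // u _; apply: fin_bigcup_measurable => // v _.
apply: measurableI; first exact: measurableI.
have [h|h] := pselect (B `|u - v|).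
  by rewrite (_ : [set _ | _] = setT) //; apply/seteqP; split.
by rewrite (_ : [set _ | _] = set0) //; apply/seteqP; split.
Qed.

Lemma measurable_strong_normB (V : normedModType R) (F G : Omega -> V) :
  strongly_measurable F -> strongly_measurable G ->
  measurable_fun setT (fun w => `|F w - G w|).
Proof.
move=> [s hs sF] [t ht tG].
apply: (measurable_fun_cvg (h := fun k w => `|s k w - t k w|)) => [k|w _].
  exact: measurable_simple_normB.
by apply: cvg_norm; apply: cvgB; [exact: sF|exact: tG].
Qed.

Lemma strongly_measurable_cst (V : normedModType R) (v : V) :
  strongly_measurable (fun=> v : V) (Omega := Omega).
Proof.
exists (fun _ _ => v) => [k|w]; last exact: cvg_cst.
split; first by apply: (sub_finite_set _ (finite_set1 v)) => _ [w _ <-].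
move=> u; have [->|uv] := eqVneq u v.
  by rewrite (_ : _ @^-1` _ = setT) //; apply/seteqP; split.
rewrite (_ : _ @^-1` _ = set0) //; apply/seteqP; split=> // w /= e.
by rewrite e eqxx in uv.
Qed.

Lemma measurable_strong_norm (V : normedModType R) (F : Omega -> V) :
  strongly_measurable F -> measurable_fun setT (fun w => `|F w|).
Proof.
move=> mF; have := measurable_strong_normB mF (strongly_measurable_cst 0).
by apply: eq_measurable_fun => w _; rewrite subr0.
Qed.

(** Hölder against the constant 1, whose conjugate norm is 1 under a probability. *)
Lemma mean_norm_le_Lp_norm (V : normedModType R) (p : R) (F : Omega -> V) :
  1 < p -> measurable_fun setT (fun w => `|F w|) ->
  (\int[P]_w `|F w|%:E <= Lp_norm P p F)%E.
Proof.
move=> p1 mF; have p0 : 0 < p by exact: lt_trans p1.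
have pm1 : 0 < p - 1 by rewrite subr_gt0.
have pq : p^-1 + (p / (p - 1))^-1 = 1.
  by rewrite invf_div -{1}[p^-1]mul1r -mulrDl addrC subrK divff // gt_eqF.
have := hoelder P mF (measurable_cst (1 : R)) p0 (divr_gt0 p0 pm1) pq.
rewrite Lnorm1 (_ : Lnorm P (p / (p - 1))%:E _ = 1%E); last first.
  have -> : EFin \o cst (1 : R) = cst 1%E by [].
  rewrite -[RHS](poweR1r (p / (p - 1))^-1) Lnorm_cst1.
  by congr (_ `^ _)%E; exact: probability_setT.
rewrite mule1; apply: le_trans; rewrite le_eqVlt; apply/orP; left; apply/eqP.
by apply: eq_integral => w _ /=; rewrite mulr1 normr_id.
Qed.

End strong_measurability.

(** * Passage to the limit along the sequence *)

Section closability.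
Context {d d' : measure_display}.
Context {Omega : measurableType d} {E : measurableType d'} {R : realType}.
Context (P : probability Omega R).
Context (mu : {sigma_finite_measure set E -> \bar R}).
Context (N : R.-ker Omega ~> E) (hN : is_poisson_random_measure P mu N).
Context {X : normedModType R} (p : R) (p1 : 1 < p).
Context {V : completeNormedModType R} (iota : (E -> X) -> V).
Hypothesis hV : is_poisson_completion P mu N p iota.

Definition cyl_fun (c : cylindrical mu (X := X))
    (n : {ffun 'I_(cyl_dim c) -> nat}) : X :=
  \sum_(i < cyl_size c) cyl_coef i n *: cyl_vec i.

Lemma cyl_disjoint_family (c : cylindrical mu (X := X)) :
  disjoint_family mu (@cyl_set _ _ _ _ _ c).
Proof. exact: cyl_setP. Qed.

Lemma cyl_evalE (c : cylindrical mu (X := X)) w :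
  cyl_eval N c w = cyl_fun (cnt N (@cyl_set _ _ _ _ _ c) w).
Proof.
rewrite /cyl_eval /cyl_fun; apply: eq_bigr => i _; congr (cyl_coef i _ *: _).
by apply/funext => m; rewrite /cnt ffunE.
Qed.

(** Exchanging the two sums shows a step function on fixed sets with random values, to which
    [step_norm_le] applies for each [w]. *)
Lemma cyl_derivE (c : cylindrical mu (X := X)) w
    (n := cnt N (@cyl_set _ _ _ _ _ c) w) :
  cyl_deriv N c w =
  stepf (@cyl_set _ _ _ _ _ c) (fun m => cyl_fun (add1 n m) - cyl_fun n).
Proof.
apply/funext => e; rewrite /cyl_deriv /stepf exchange_big /=.
apply: eq_bigr => m _; rewrite /cyl_fun -sumrB scaler_sumr; apply: eq_bigr => i _.
rewrite -scalerBl !scalerA mulrC; congr ((_ * (cyl_coef i _ - cyl_coef i _)) *: _).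
  by apply/funext => l; rewrite /add_unit /n /add1 /cnt !ffunE.
by apply/funext => l; rewrite /n /cnt !ffunE.
Qed.

Lemma measurable_near_step (J : finType) (C : J -> set E) (v : V) (delta : R)
    (L : nat) (G : Omega -> V) : disjoint_family mu C -> strongly_measurable G ->
  measurable [set w | `|G w - v| < delta /\ (forall j, (cnt N C w j < L)%N)].
Proof.
move=> fC mG; have mC n : measurable [set w | cnt N C w = n].
  by apply: (measurable_cnt hN) => a; exact: (fC.1 a).1.
rewrite (_ : [set w | _] = (fun w => `|G w - v|) @^-1` `]-oo, delta[%classic `&`
    (cnt N C @^-1` [set n | forall j, (n j < L)%N])); last first.
  by apply/seteqP; split=> w; rewrite /= in_itv.
apply: measurableI; last exact: measurable_discrete.
rewrite -[X in measurable X]setTI.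
by apply: (measurable_strong_normB mG (strongly_measurable_cst v)).
Qed.

(** A Markov-type bound: on the event, the error [G' - G] and the averaged derivative together must
    make up for the gap between the norm of the step function and [delta]. *)
Lemma near_step_prob_le (J : finType) (C : J -> set E) (x : J -> X) (c : J -> R)
    (delta : R) (L : nat) (F : Omega -> X) (G' G : Omega -> V) :
  disjoint_family mu C -> delta <= `|iota (stepf C x)| -> (forall j, 0 <= c j) ->
  (forall (I : finType) (B : I -> set E) (y : I -> X), disjoint_family mu B ->
    `|iota (stepf C x)| <= `|iota (stepf C x) - iota (stepf B y)| +
      \sum_j c j * `|\sum_m meet_rate mu C B j m *: y m|) ->
  strongly_measurable F -> strongly_measurable G' -> strongly_measurable G ->
  malliavin P mu N iota F G' ->
  ((`|iota (stepf C x)| - delta)%R%:E *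
     P [set w | (`|G w - iota (stepf C x)| < delta)%R /\
                (forall j, (cnt N C w j < L)%N)] <=
   Lp_norm P p (fun w => (G' w - G w)%R) +
   (\sum_j c j * (L%:R + rate mu C j))%R%:E * Lp_norm P p F)%E.
Proof.
move=> fC dl c0 hc mF mG' mG [cy [Fae Gae]].
set phi := iota (stepf C x).
pose B := @cyl_set _ _ _ _ _ cy.
have fB : disjoint_family mu B by exact: cyl_disjoint_family.
pose D j w := `|\sum_m meet_rate mu C B j m *:
   (cyl_fun (add1 (cnt N B w) m) - cyl_fun (cnt N B w))|.
pose S := [set w | `|G w - phi| < delta /\ (forall j, (cnt N C w j < L)%N)].
have mC n : measurable [set w | cnt N C w = n].
  by apply: (measurable_cnt hN) => a; exact: (fC.1 a).1.
have mB n : measurable [set w | cnt N B w = n].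
  by apply: (measurable_cnt hN) => a; exact: (fB.1 a).1.
have mH j : measurable [set w | (cnt N C w j < L)%N].
  exact: (measurable_discrete mC [set n | (n j < L)%N]).
have mS : measurable S by exact: measurable_near_step.
have mD j : measurable_fun setT (fun w => (D j w)%:E : \bar R).
  exact: (measurable_fun_discrete mB (fun n => `|\sum_m meet_rate mu C B j m *:
   (cyl_fun (add1 n m) - cyl_fun n)|%:E)).
have mcD j : measurable_fun setT (fun w => (c j * D j w)%:E : \bar R).
  exact: (measurable_fun_discrete mB (fun n => (c j * `|\sum_m meet_rate mu C B j m *:
   (cyl_fun (add1 n m) - cyl_fun n)|)%:E)).
have mGG : measurable_fun setT (fun w => `|G' w - G w|%:E).
  by apply/measurable_EFinP; exact: measurable_strong_normB.
have FE : (\int[P]_w `|cyl_fun (cnt N B w)|%:E = \int[P]_w `|F w|%:E)%E.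
  apply: ge0_ae_eq_integral => //.
  - exact: (measurable_fun_discrete mB (fun n => `|cyl_fun n|%:E)).
  - by apply/measurable_EFinP; exact: measurable_strong_norm.
  - by apply: filterS Fae => w -> _; rewrite cyl_evalE.
have D0 j w : 0 <= c j * D j w by rewrite mulr_ge0 // /D.
apply: (@le_trans _ _ (\int[P]_(w in S)
    (`|G' w - G w|%:E + \sum_j (c j * D j w)%:E))%E).
  rewrite -integral_cst //; apply: ae_ge0_le_integral.
  - exact: mS.
  - by move=> w _; rewrite lee_fin subr_ge0.
  - exact: measurable_cst.
  - by move=> w _; rewrite adde_ge0 // sume_ge0 // => j _; rewrite lee_fin.
  - apply: emeasurable_funD; first exact: measurable_funTS.
    by apply: emeasurable_sum => j; exact: measurable_funTS.
  - apply: filterS Gae => w GE [Sw _].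
    have := hc _ B (fun m => cyl_fun (add1 (cnt N B w) m) - cyl_fun (cnt N B w)) fB.
    rewrite -cyl_derivE -GE -/phi => h.
    rewrite sumEFin -EFinD lee_fin lerBlDr; apply: (le_trans h).
    rewrite addrAC lerD2r -[phi - G' w](subrKA (G w)).
    apply: (le_trans (ler_normD _ _)); rewrite [leRHS]addrC [`|G' w - _|]distrC lerD2r.
    by rewrite distrC ltW.
rewrite ge0_integralD //; first last.
- by apply: emeasurable_sum => j; exact: measurable_funTS.
- by move=> w _; rewrite sume_ge0 // => j _; rewrite lee_fin.
- exact: measurable_funTS.
apply: leeD.
  apply: le_trans (mean_norm_le_Lp_norm P p1 (measurable_strong_normB mG' mG)).
  exact: ge0_subset_integral.
rewrite ge0_integral_sum //; first last.
- by move=> j w _; rewrite lee_fin.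
- by move=> j; exact: measurable_funTS.
rewrite -sumEFin ge0_sume_distrl; last first.
  by move=> j _; rewrite lee_fin mulr_ge0 ?addr_ge0 ?rate_ge0.
apply: lee_sum => j _.
rewrite EFinM -muleA; under eq_integral do rewrite EFinM.
rewrite ge0_integralZl //; first last.
- by rewrite lee_fin.
- by move=> w _; rewrite lee_fin /D.
- exact: measurable_funTS.
apply: lee_wpmul2l; first by rewrite lee_fin.
(* The event is enlarged to the truncation on [C j] alone, as [derivative_mean_le] requires. *)
apply: (@le_trans _ _ (\int[P]_(w in [set w | (cnt N C w j < L)%N]) (D j w)%:E)%E).
  apply: ge0_subset_integral => //; first exact: measurable_funTS.
    by move=> w _; rewrite lee_fin /D.
  by move=> w [_ h]; exact: h.
apply: (le_trans (derivative_mean_le hN fC fB _ j L)).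
apply: lee_wpmul2l; first by rewrite lee_fin addr_ge0 ?rate_ge0.
by rewrite FE; apply: (mean_norm_le_Lp_norm P p1 (measurable_strong_norm mF)).
Qed.

(** For fixed [L] the left side of [near_step_prob_le] does not involve [k], while the right side
    tends to 0. *)
Lemma near_step_negligible (J : finType) (C : J -> set E) (x : J -> X)
    (delta : R) (F_ : nat -> Omega -> X) (G_ : nat -> Omega -> V)
    (G : Omega -> V) :
  disjoint_family mu C -> delta < `|iota (stepf C x)| ->
  (forall k, [/\ in_Lp P p (F_ k), in_Lp P p (G_ k) &
                 malliavin P mu N iota (F_ k) (G_ k)]) ->
  in_Lp P p G ->
  Lp_norm P p (F_ k) @[k --> \oo] --> 0%E ->
  Lp_norm P p (fun w => G_ k w - G w) @[k --> \oo] --> 0%E ->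
  P.-negligible [set w | `|G w - iota (stepf C x)| < delta].
Proof.
move=> fC dl hFG [mG _] F0 G0.
have [c c0 hc] := step_norm_le hN p1 hV x fC.
pose S L := [set w | `|G w - iota (stepf C x)| < delta /\
                     (forall j, (cnt N C w j < L)%N)].
apply: (@negligibleS _ _ _ _ (\bigcup_L S L)).
  move=> w /= h; exists (\max_j cnt N C w j).+1 => //; split=> // j.
  by rewrite ltnS; exact: (leq_bigmax j).
apply: negligible_bigcup => L.
have mS : measurable (S L) by exact: measurable_near_step.
exists (S L); split=> //.
pose K := \sum_j c j * (L%:R + rate mu C j).
have e0 : (Lp_norm P p (fun w => (G_ k w - G w)%R) + K%:E * Lp_norm P p (F_ k))%E
    @[k --> \oo] --> (0 + K%:E * 0)%E.
  by apply: cvgeD => //; exact: cvgeZl.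
rewrite mule0 adde0 in e0.
have : ((`|iota (stepf C x)| - delta)%:E * P (S L) <= 0)%E.
  apply: (cvge_to_ge e0); apply: nearW => k; have [[mF _] [mG' _] hm] := hFG k.
  exact: near_step_prob_le (ltW dl) c0 hc mF mG' mG hm.
have eta0 : 0 < `|iota (stepf C x)| - delta by rewrite subr_gt0.
rewrite pmule_rle0 ?lte_fin// => PS; apply/eqP.
by rewrite eq_le PS measure_ge0.
Qed.

End closability.

Unset Implicit Arguments.
Set Strict Implicit.
Set Printing Implicit Defensive.

Theorem theorem5p6 (R : realType) (d d' : measure_display)
    (Omega : measurableType d) (E : measurableType d')
    (P : probability Omega R)
    (mu : {sigma_finite_measure set E -> \bar R})
    (N : R.-ker Omega ~> E) (hN : is_poisson_random_measure P mu N)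
    (X : completeNormedModType R) (p : R) (hp : 1 < p)
    (V : completeNormedModType R) (iota : (E -> X) -> V)
    (hV : is_poisson_completion P mu N p iota) :
  closable_Lp P p (malliavin P mu N iota).
Proof.
move=> F_ G_ G hFG hG F0 G0.
(* Take a step function [phi] within [e] of [v]. If its norm is at most [2 * e], then [G w] has norm
   below [4 * e], which is excluded; otherwise the ball of radius [2 * e] around [phi] contains
   [G w] and avoids 0. *)
have cover (v : V) (e : R) : 0 < e -> exists Z : set Omega, P.-negligible Z /\
    forall w, `|G w - v| < e -> 5 * e < `|G w| -> Z w.
  move=> e0; case: (hV) => _ _ dense.
  have : closure (iota @` [set f | is_step_fun mu f]) v by rewrite dense.
  move=> /(_ _ (nbhsx_ballx v _ e0)) [_ [[f [M [C [x [fC ->]]]] <-]]].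
  rewrite -ball_normE /= => vphi.
  have fC' : disjoint_family mu C by exact: fC.
  pose phi := iota (stepf C x).
  have [big|small] := ltP (2 * e) `|phi|; last first.
    exists set0; split; first exact: negligible_set0.
    move=> w Gv Gbig; exfalso.
    have := ler_normD (G w - v) (v - phi + phi).
    have := ler_normD (v - phi) phi.
    rewrite subrK subrK => h1 h2.
    have vphi' : `|v - phi| < e by exact: vphi.
    lra.
  exists [set w | `|G w - phi| < 2 * e]; split.
    exact: (near_step_negligible hN hp hV fC' big hFG hG F0 G0).
  move=> w Gv _ /=.
  have := ler_normD (G w - v) (v - phi); rewrite addrA subrK => h.
  have vphi' : `|v - phi| < e by exact: vphi.
  lra.
have inv0 l : 0 < l.+1%:R^-1 :> R by rewrite invr_gt0.
have [Z hZ] := choice (fun vl : V * nat => cover vl.1 _ (inv0 vl.2)).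
have [[s hs sG] _] := hG.
(* The values of the approximating [s k] are countably many centres, so the union of their
   exceptional sets stays negligible. *)
have /choice[q hq] : forall k, exists q : seq V, range (s k) = [set` q].
  by move=> k; have [/finite_seqP] := hs k.
have neg : P.-negligible (\bigcup_k \bigcup_i \bigcup_l Z (nth 0 (q k) i, l)).
  by do 3! apply: negligible_bigcup => ?; exact: (hZ _).1.
(* Where [G w] is nonzero, pick a radius below a fifth of its norm, then [k] with [s k w] within
   that radius. *)
apply: negligibleS neg => w /= /eqP Gn0.
have [l hl] : exists l : nat, 5 * l.+1%:R^-1 < `|G w|.
  have G5 : 0 < `|G w| / 5 by rewrite divr_gt0 // normr_gt0.
  have [l _ hl] := near_infty_natSinv_lt (PosNum G5).
  by exists l; have /= := hl l (leqnn _); rewrite ltr_pdivlMr // mulrC.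
have [k _ hk] := (cvgrPdist_lt _ _).1 (sG w) _ (inv0 l).
have : [set` q k] (s k w) by rewrite -hq; exists w.
move=> /= skq; exists k => //; exists (index (s k w) (q k)) => //; exists l => //.
apply: (hZ _).2 => //=; rewrite nth_index //.
by apply: hk => /=.
Qed.
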